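(* There exists a function $f_1:\mathbb{N}\to\mathbb{N}$ such that every rational matrix $A$ with $\dim\ker A>0$ satisfies the following: (i) $A$ is equivalent to a matrix $A'$ with $\mathrm{td}_D(A')\le c_1(A)^2$ and $\mathrm{ec}(A')\le 2\lceil c_1(A)\rceil$; and (ii) $c_1(A)\le g_1(A)\le f_1(c_1(A))$.
   Context: Two matrices are equivalent if one can be obtained from the other by a finite sequence of row operations: adding a multiple of one row to another row, and multiplying a row by a nonzero scalar. For a graph $G$, the tree-depth is the minimum height (maximum number of vertices on a root-to-leaf path) of a rooted forest $F$ on $V(G)$ such that every edge of $G$ joins a vertex to one of its ancestors in $F$. The dual graph of a matrix has its rows as vertices, two rows adjacent if some column has non-zero entries in both; $\mathrm{td}_D(A)$ is the tree-depth of the dual graph of $A$. The entry complexity $\mathrm{ec}(A)$ of a rational matrix is the maximum, over all entries $p/q$ of $A$ with $p,q$ coprime integers, of $\lceil\log_2(|p|+1)\rceil+\lceil\log_2(|q|+1)\rceil$. A circuit of $A$ is a non-zero integral vector in $\ker A$ whose entries are coprime and whose support is inclusion-wise minimal among supports of non-zero vectors of $\ker A$; $c_1(A)$ is the maximum $\ell_1$-norm of a circuit of $A$. For vectors $x,y$ write $x\sqsubseteq y$ if $|x_i|\le|y_i|$ and $x_iy_i\ge 0$ for all $i$. The Graver basis of $A$ is the set of $\sqsubseteq$-minimal non-zero elements of $\ker A\cap\mathbb{Z}^n$, and $g_1(A)$ is the maximum $\ell_1$-norm of an element of the Graver basis. *)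

(* Defs.v *)
From mathcomp Require Import all_boot all_order all_algebra.
From mathcomp Require Import boolp classical_sets.

Set Implicit Arguments.
Unset Strict Implicit.
Unset Printing Implicit Defensive.

Import Order.TTheory GRing.Theory Num.Theory.
Local Open Scope ring_scope.

Inductive row_equiv (m n : nat) (A : 'M[rat]_(m, n)) : 'M[rat]_(m, n) -> Prop :=
| row_equiv_refl : row_equiv A A
| row_equiv_add (B : 'M[rat]_(m, n)) (i j : 'I_m) (a : rat) :
    row_equiv A B -> i != j ->
    row_equiv A
      (\matrix_(k < m) (if k == i then row i B + a *: row j B else row k B))
| row_equiv_scale (B : 'M[rat]_(m, n)) (i : 'I_m) (a : rat) :
    row_equiv A B -> a != 0 ->
    row_equiv A
      (\matrix_(k < m) (if k == i then a *: row i B else row k B)).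

(* A rooted forest on T is given by its parent map F, roots being sent to
   None; ancestor F x y means that y is on the path from x to its root
   (so every vertex is an ancestor of itself). *)
Definition ancestor (T : finType) (F : {ffun T -> option T}) : rel T :=
  connect (fun x y => F x == Some y).

Definition is_forest (T : finType) (F : {ffun T -> option T}) : bool :=
  [forall x, forall y, (F x == Some y) ==> ~~ ancestor F y x].

(* The vertices on the path from x to its root are the ancestors of x, and a
   longest root-to-leaf path starts at a vertex with most ancestors. *)
Definition forest_height (T : finType) (F : {ffun T -> option T}) : nat :=
  \max_(x : T) #|[set y | ancestor F x y]%SET|.

Definition closure_contains (T : finType) (F : {ffun T -> option T})
    (e : rel T) : bool :=
  [forall x, forall y, e x y ==> ancestor F x y || ancestor F y x].

(* The default value #|T| does not affect the minimum: a path on T is an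
   admissible forest, and no forest on T has height more than #|T|. *)
Definition tree_depth (T : finType) (e : rel T) : nat :=
  \big[minn/#|T|]_(F : {ffun T -> option T}
                     | is_forest F && closure_contains F e) forest_height F.

Definition dual_graph (m n : nat) (A : 'M[rat]_(m, n)) : rel 'I_m :=
  fun i j => (i != j) && [exists k, (A i k != 0) && (A j k != 0)].

Definition td_D (m n : nat) (A : 'M[rat]_(m, n)) : nat :=
  tree_depth (dual_graph A).

(* up_log 2 k is the ceiling of log_2 k for k >= 1. *)
Definition rat_complexity (x : rat) : nat :=
  (up_log 2 (`|numq x|%N + 1) + up_log 2 (`|denq x|%N + 1))%N.

Definition ec (m n : nat) (A : 'M[rat]_(m, n)) : nat :=
  \max_(i < m) \max_(j < n) rat_complexity (A i j).

Definition dim_ker (m n : nat) (A : 'M[rat]_(m, n)) : nat :=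
  \rank (cokermx A).

Definition in_ker (m n : nat) (A : 'M[rat]_(m, n)) (y : 'cV[rat]_n) : Prop :=
  A *m y = 0.

Definition int_in_ker (m n : nat) (A : 'M[rat]_(m, n)) (x : 'cV[int]_n) : Prop :=
  in_ker A (map_mx (intr : int -> rat) x).

Definition supp (R : nmodType) (n : nat) (y : 'cV[R]_n) : {set 'I_n} :=
  [set i | y i 0 != 0]%SET.

Definition norm1 (n : nat) (x : 'cV[int]_n) : nat :=
  (\sum_(i < n) `|x i 0%R|)%N.

Definition coprime_entries (n : nat) (x : 'cV[int]_n) : Prop :=
  \big[gcdn/0%N]_(i < n) `|x i 0%R|%N = 1%N.

Definition circuit (m n : nat) (A : 'M[rat]_(m, n)) (x : 'cV[int]_n) : Prop :=
  [/\ x != 0, int_in_ker A x, coprime_entries x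
    & forall y : 'cV[rat]_n,
        y != 0 -> in_ker A y -> ~~ (supp y \proper supp x)].

Definition conformal_le (n : nat) (x y : 'cV[int]_n) : Prop :=
  forall i : 'I_n, `|x i 0| <= `|y i 0| /\ 0 <= x i 0 * y i 0.

Definition graver (m n : nat) (A : 'M[rat]_(m, n)) (x : 'cV[int]_n) : Prop :=
  [/\ x != 0, int_in_ker A x
    & forall y : 'cV[int]_n,
        y != 0 -> int_in_ker A y -> conformal_le y x -> y = x].

Definition is_max_norm1 (n : nat) (P : 'cV[int]_n -> Prop) (k : nat) : Prop :=
  (exists2 x, P x & norm1 x = k) /\ (forall x, P x -> (norm1 x <= k)%N).

(* The unique k with is_max_norm1 P k, or 0 if there is none. The latter does
   not occur for the circuits and the Graver basis of a matrix with non-trivial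
   kernel, which are finite non-empty sets. *)
Definition max_norm1 (n : nat) (P : 'cV[int]_n -> Prop) : nat :=
  xget 0%N (is_max_norm1 P).

Definition c1 (m n : nat) (A : 'M[rat]_(m, n)) : nat := max_norm1 (circuit A).

Definition g1 (m n : nat) (A : 'M[rat]_(m, n)) : nat := max_norm1 (graver A).

(* Main.v *)
Require Import Defs.
From mathcomp Require Import all_boot all_order all_algebra.
From mathcomp Require Import boolp.
From mathcomp Require Import zify ring.

(** A longest circuit [C] of a connected linear matroid meets the others so
    tightly that every circuit of the contraction by [C] is shorter than [C].
    Contracting longest circuits component by component, with all but one
    element of each put into a basis, therefore gives a basis whose reduced
    row echelon form has dual tree-depth quadratic in the size of the largest
    circuit: the contracted elements are a path at the top of the tree of their
    component.  The entries of the reduced form are ratios of entries of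
    fundamental circuits.

    For the Graver basis, remove the root row of a component.  An element of
    the Graver basis is a conformal sum of Graver elements [h] of the remaining
    matrix, and the root row takes small integral values on the summands.
    Ordering the summands so that the partial sums of these values stay small,
    two of many partial sums coincide and yield a proper conformal summand in
    the kernel; hence there are few summands. *)

Set Implicit Arguments.
Unset Strict Implicit.
Unset Printing Implicit Defensive.

Import Order.TTheory GRing.Theory Num.Theory.
Local Open Scope ring_scope.

(** * Circuits *)

(** The matroid is handled through its space of dependencies: a subspace [V] of column vectors whose
    vectors of minimal support are the circuits. Circuit elimination becomes subtraction of a
    multiple, and tree-depth is controlled by the pairs of basis elements that a vector of [V] can
    join, so it can be tracked under contraction before any matrix is reduced. The obstacle in the
    contraction step is a circuit disjoint from the longest one and independent of it: connectivity
    has to supply a circuit meeting both, from which two circuits of larger total length are built.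
    Circuit length [k] costs at most [k - 1] tree levels before the length drops, which is why the
    depth is quadratic. The number [c1] serves twice: it bounds the supports of circuits, hence the
    depth, and their entries, hence numerators and denominators. *)

Definition subspace (K : fieldType) n (V : 'cV[K]_n -> Prop) :=
  V 0 /\ forall a u v, V u -> V v -> V (a *: u + v).

Definition elementary (K : fieldType) n (V : 'cV[K]_n -> Prop) (x : 'cV[K]_n) :=
  [/\ x != 0, V x & forall y, y != 0 -> V y -> ~~ (supp y \proper supp x)].

Lemma subspaceBZ (K : fieldType) n (V : 'cV[K]_n -> Prop) u v a :
  subspace V -> V u -> V v -> V (u - a *: v).
Proof. by case=> _ h Vu Vv; rewrite addrC -scaleNr; apply: h. Qed.

Lemma in_supp (R : nmodType) n (x : 'cV[R]_n) i : (i \in supp x) = (x i 0 != 0).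
Proof. by rewrite inE. Qed.

Lemma col_eqP (R : nmodType) n (x y : 'cV[R]_n) :
  (forall i, x i 0 = y i 0) -> x = y.
Proof. by move=> h; apply/matrixP=> i j; rewrite ord1. Qed.

Lemma col_neq0P (R : nmodType) n (x : 'cV[R]_n) :
  reflect (exists i, x i 0 != 0) (x != 0).
Proof.
apply: (iffP idP) => [|[i]]; last by apply: contra_neq => ->; rewrite mxE.
apply: contra_neqP => /forallNP h; apply: col_eqP => i; rewrite mxE.
by apply/eqP/negPn/negP; apply: h.
Qed.

Lemma subsuppP (R : nmodType) n (x : 'cV[R]_n) (S : {set 'I_n}) :
  reflect (forall i, i \notin S -> x i 0 = 0) (supp x \subset S).
Proof.
apply: (iffP idP) => [/subsetP h i iS | h].
  by apply/eqP/negPn; rewrite -in_supp; apply: contra iS; apply: h.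
by apply/subsetP => i; rewrite in_supp; apply: contraR => /h ->.
Qed.

Section Circuits.
Context (K : fieldType) (n : nat).
Implicit Types (V : 'cV[K]_n -> Prop) (x y z w : 'cV[K]_n) (P S : {set 'I_n}).

Lemma elementary_prop V x w : subspace V -> elementary V x -> V w ->
  supp w \subset supp x -> exists a, w = a *: x.
Proof.
move=> sV [x0 Vx xmin] Vw wx.
have [i xi] := col_neq0P _ x0.
exists (w i 0 / x i 0); apply/eqP; rewrite -subr_eq0; apply/negPn/negP => u0.
have /negP := xmin _ u0 (subspaceBZ _ sV Vw Vx); apply; apply/properP; split.
  apply/subsuppP=> j jx; rewrite !mxE (subsuppP _ _ wx _ jx).
  by move: jx; rewrite in_supp negbK => /eqP ->; rewrite mulr0 subrr.
by exists i; rewrite in_supp // !mxE divfK // subrr eqxx.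
Qed.

(** If [w] is not minimal, a vector [u] of smaller support either contains [e] itself, or can be
    subtracted from [w] to shrink the support without touching coordinate [e]. *)
Lemma elementary_through V w e : subspace V -> V w -> w e 0 != 0 ->
  exists z, [/\ elementary V z, supp z \subset supp w & z e 0 != 0].
Proof.
move=> sV; have [k] := ubnP #|supp w|; elim: k w => // k IH w; rewrite ltnS => lek Vw we.
have w0 : w != 0 by apply/col_neq0P; exists e.
have [[u [u0 Vu uw]]|nou] := pselect (exists u : 'cV[K]_n,
    [/\ u != 0, V u & supp u \proper supp w]); last first.
  exists w; split=> //; split=> // u u0 Vu; apply/negP => uw; by case: nou; exists u.
have red v : V v -> supp v \proper supp w -> v e 0 != 0 ->
  exists z, [/\ elementary V z, supp z \subset supp w & z e 0 != 0].
  move=> Vv vw ve; have [] := IH v _ Vv ve; first exact: leq_trans (proper_card vw) lek.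
  by move=> z [ez zv ze]; exists z; split=> //; apply: subset_trans zv (proper_sub vw).
have [ue|ue] := eqVneq (u e 0) 0; last exact: (red u).
have [i ui] := col_neq0P _ u0.
apply: (red (w - (w i 0 / u i 0) *: u)); first exact: subspaceBZ.
  apply/properP; split.
    apply/subsuppP=> j jw; rewrite !mxE (subsuppP _ _ (proper_sub uw) _ jw).
    by move: jw; rewrite in_supp negbK => /eqP ->; rewrite mulr0 subrr.
  exists i; last by rewrite in_supp // !mxE divfK // subrr eqxx.
  by apply: (subsetP (proper_sub uw)); rewrite in_supp.
by rewrite !mxE ue mulr0 subr0.
Qed.

(* The classical matroid argument: a pair of circuits with smallest union
   among the counterexamples is improved by two strong eliminations. *)
Lemma elementary_trans V x y e f g : subspace V ->
  elementary V x -> elementary V y -> x e 0 != 0 -> y f 0 != 0 ->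
  x g 0 != 0 -> y g 0 != 0 ->
  exists z, [/\ elementary V z, z e 0 != 0 & z f 0 != 0].
Proof.
move=> sV; have [k] := ubnP #|supp x :|: supp y|.
elim: k x y g => // k IH x y g; rewrite ltnS => lek ex ey xe yf xg yg.
apply: contrapT => no.
have xf : x f 0 = 0 by apply/eqP/negPn/negP => xf; apply: no; exists x.
have ye : y e 0 = 0 by apply/eqP/negPn/negP => ye; apply: no; exists y.
have [_ Vx _] := ex; have [_ Vy _] := ey.
pose w : 'cV[K]_n := x - (x g 0 / y g 0) *: y.
have Vw : V w by apply: subspaceBZ.
have wg : w g 0 = 0 by rewrite !mxE divfK // subrr.
have we : w e 0 != 0 by rewrite !mxE ye mulr0 subr0.
have wf : w f 0 != 0.
  by rewrite !mxE xf sub0r oppr_eq0 mulf_neq0 // mulf_neq0 // invr_eq0.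
have wxy i : x i 0 = 0 -> y i 0 = 0 -> w i 0 = 0.
  by rewrite !mxE => -> ->; rewrite mulr0 subrr.
have [x' [ex' x'w x'e]] := elementary_through sV Vw we.
have [y' [ey' y'w y'f]] := elementary_through sV Vw wf.
have inw (v : 'cV[K]_n) : supp v \subset supp w ->
    v g 0 = 0 /\ forall i, x i 0 = 0 -> y i 0 = 0 -> v i 0 = 0.
  move/subsuppP => h; split; first by apply: h; rewrite in_supp wg eqxx.
  by move=> i xi yi; apply: h; rewrite in_supp (wxy _ xi yi) eqxx.
have [x'g x'xy] := inw x' x'w; have [y'g y'xy] := inw y' y'w.
have outside (v u : 'cV[K]_n) : elementary V v -> elementary V u -> v g 0 = 0 -> u g 0 != 0 ->
    exists i, v i 0 != 0 /\ u i 0 = 0.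
  move=> ev eu vg ug; apply: contrapT => nos.
  have [] := @elementary_prop V u v sV eu; first by case: ev.
    apply/subsuppP=> i; rewrite in_supp negbK => /eqP ui.
    by apply/eqP/negPn/negP => vi; apply: nos; exists i.
  move=> a va; case: ev => /col_neq0P[i vi] _ _; move: vi.
  move: vg; rewrite va !mxE => /eqP; rewrite mulf_eq0 (negPf ug) orbF => /eqP ->.
  by rewrite mul0r eqxx.
have union_lt (v u : 'cV[K]_n) i : (forall j, x j 0 = 0 -> y j 0 = 0 -> v j 0 = 0) ->
    (forall j, x j 0 = 0 -> y j 0 = 0 -> u j 0 = 0) ->
    (x i 0 != 0) || (y i 0 != 0) -> v i 0 = 0 -> u i 0 = 0 ->
    (#|supp v :|: supp u| < k)%N.
  move=> hv hu xyi vi ui; apply: leq_trans lek; apply: proper_card; apply/properP; split.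
    apply/subsetP=> j; rewrite !inE; apply: contraLR; rewrite !negb_or !negbK.
    by move=> /andP[/eqP xj /eqP yj]; rewrite hv // hu // eqxx.
  by exists i; rewrite !inE ?vi ?ui ?eqxx // xyi.
have hx i : x i 0 = 0 -> y i 0 = 0 -> x i 0 = 0 by [].
have hy i : x i 0 = 0 -> y i 0 = 0 -> y i 0 = 0 by [].
(* A failure at [i] would leave [x'] and [y] still intersecting, with a union that omits [i]: a
   smaller counterexample. The next claim is the mirror image. *)
have x'big i : x i 0 != 0 -> y i 0 = 0 -> x' i 0 != 0.
  move=> xi yi; apply/negP => /eqP x'i.
  have [j [x'j xj]] := outside _ _ ex' ex x'g xg.
  have yj : y j 0 != 0 by apply: contra_neq x'j => /(x'xy _ xj).
  by apply: no; apply: (IH x' y j) => //; apply: (union_lt _ _ i) => //; rewrite xi.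
have y'big i : y i 0 != 0 -> x i 0 = 0 -> y' i 0 != 0.
  move=> yi xi; apply/negP => /eqP y'i.
  have [j [y'j yj]] := outside _ _ ey' ey y'g yg.
  have xj : x j 0 != 0 by apply: contra_neq y'j => /y'xy; apply.
  by apply: no; apply: (IH x y' j) => //; apply: (union_lt _ _ i) => //; rewrite yi orbT.
(* [x'] leaves [supp x], hence meets [supp y] at some [j] where [y'] is nonzero too; the union of
   [x'] and [y'] omits [g]. *)
have [j [x'j xj]] := outside _ _ ex' ex x'g xg.
have yj : y j 0 != 0 by apply: contra_neq x'j => /(x'xy _ xj).
apply: no; apply: (IH x' y' j) => //; last exact: y'big.
by apply: (union_lt _ _ g) => //; rewrite xg.
Qed.

Definition proj P x : 'cV[K]_n := \col_i (if i \in P then x i 0 else 0).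

Lemma projE P x i : proj P x i 0 = if i \in P then x i 0 else 0.
Proof. by rewrite mxE. Qed.

(** Equivalently, [V] is the direct sum of its parts inside and outside [P]: the set [P] is a
    separator of the matroid. *)
Definition closed_under_proj V P := forall v, V v -> V (proj P v).

Definition linked V e f := exists z, [/\ elementary V z, z e 0 != 0 & z f 0 != 0].

(** By transitivity every circuit lies inside the class of [e] or outside it, so the projection
    fixes or kills it; every vector of [V] is a combination of circuits. *)
Lemma linked_closed V e : subspace V ->
  closed_under_proj V [set f | `[< linked V e f >]].
Proof.
move=> sV v; set P := [set f | _].
have [k] := ubnP #|supp v|; elim: k v => // k IH v; rewrite ltnS => lek Vv.
have [->|/col_neq0P [f vf]] := eqVneq v 0.
  by rewrite (_ : proj P 0 = 0); [case: sV | apply: col_eqP=> i; rewrite !mxE if_same].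
have [z [ez zv zf]] := elementary_through sV Vv vf.
have Vz : V z by case: ez.
have zP : V (proj P z).
  have [[i [zi iP]]|no] := pselect (exists i, z i 0 != 0 /\ i \in P).
    suff -> : proj P z = z by [].
    apply: col_eqP=> j; rewrite projE; case: ifP => // /negP jP.
    apply/esym/eqP/negPn/negP => zj; apply: jP; rewrite inE.
    move: iP; rewrite inE => /asboolP[u [eu ue ui]]; apply/asboolP.
    exact: (elementary_trans sV eu ez ue zj ui zi).
  suff -> : proj P z = 0 by case: sV.
  apply: col_eqP=> j; rewrite projE mxE; case: ifP => // jP.
  by apply/eqP/negPn/negP => zj; apply: no; exists j.
set a := v f 0 / z f 0.
have -> : proj P v = a *: proj P z + proj P (v - a *: z).
  by apply: col_eqP=> i; rewrite !mxE; case: ifP => _; ring.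
case: (sV) => _; apply=> //; apply: IH; last exact: subspaceBZ.
apply: leq_trans lek; apply: proper_card; apply/properP; split.
  apply/subsuppP=> i iv; rewrite !mxE (subsuppP _ _ zv _ iv) mulr0 subr0.
  by apply/eqP; rewrite -[_ == _]negbK -in_supp.
by exists f; rewrite in_supp // !mxE divfK // subrr eqxx.
Qed.

End Circuits.

(** * Contraction of a longest circuit *)

Lemma exists_min (T : Type) (P : T -> Prop) (m : T -> nat) :
  (exists t, P t) -> exists t, P t /\ forall u, P u -> (m t <= m u)%N.
Proof.
case=> t Pt; have [k] := ubnP (m t); elim: k t Pt => // k IH t Pt; rewrite ltnS => tk.
have [[u [Pu ut]]|no] := pselect (exists u, P u /\ (m u < m t)%N).
  exact: (IH u Pu (leq_trans ut tk)).
by exists t; split=> // u Pu; rewrite leqNgt; apply/negP => ut; apply: no; exists u.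
Qed.

Section LongCircuits.
Context (K : fieldType) (n : nat).
Implicit Types (V : 'cV[K]_n -> Prop) (x y z w : 'cV[K]_n) (C D P S : {set 'I_n}).

Lemma elementaryI V x : x != 0 -> V x ->
  (forall w, V w -> supp w \subset supp x -> exists a, w = a *: x) ->
  elementary V x.
Proof.
move=> x0 Vx h; split=> // w w0 Vw; apply/negP => /properP[wx [i ix iw]].
have [a wa] := h w Vw wx.
have a0 : a != 0 by apply: contra_neq w0 => a0; rewrite wa a0 scale0r.
by move: iw; rewrite wa in_supp mxE mulf_neq0 // -in_supp.
Qed.

(** The circuits of the matroid contraction are the minimal nonempty sets [supp v :\: C], that is,
    the minimal supports once the coordinates in [C] are erased. These are kept as zeros, so that
    the dimension [n] does not change. *)
Definition contract V C : 'cV[K]_n -> Prop :=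
  fun w => exists2 v, V v & w = proj (~: C) v.

Lemma contract_subspace V C : subspace V -> subspace (contract V C).
Proof.
case=> V0 VD; split.
  by exists 0 => //; apply: col_eqP=> i; rewrite !mxE if_same.
move=> a _ _ [u Vu ->] [v Vv ->]; exists (a *: u + v); first exact: VD.
by apply: col_eqP=> i; rewrite !mxE; case: ifP => //; rewrite mulr0 addr0.
Qed.

(* [z] and [w] are eliminated at [h]: the resulting circuit through [D] either
   violates the choice of [z] or has its support inside that of [z]. *)
Lemma linking_one_sided V C D z w c e h : subspace V -> elementary V z ->
  c \in C -> c \notin D -> z c 0 != 0 -> e \in D -> z e 0 != 0 ->
  (forall z2 c2 e2, elementary V z2 -> c2 \in C -> z2 c2 0 != 0 ->
     e2 \in D -> z2 e2 0 != 0 ->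
     (#|supp z :\: (C :|: D)| <= #|supp z2 :\: (C :|: D)|)%N) ->
  V w -> supp w \subset C :|: supp z -> (forall i, i \in D -> w i 0 = 0) ->
  h \notin C -> h \notin D -> w h 0 = 0.
Proof.
move=> sV ez cC cD zc eD ze zmin Vw wCz wD hC hD.
apply/eqP/negPn/negP => wh.
have zh : z h 0 != 0.
  move: (subsetP wCz h); rewrite in_supp => /(_ wh).
  by rewrite inE (negPf hC) in_supp.
have [_ Vz zel] := ez.
pose v : 'cV[K]_n := z - (z h 0 / w h 0) *: w.
have ve : v e 0 != 0 by rewrite !mxE (wD _ eD) mulr0 subr0.
have [z' [ez' z'v z'e]] := elementary_through sV (subspaceBZ (z h 0 / w h 0) sV Vz Vw) ve.
have vout i : z i 0 = 0 -> i \notin C -> z' i 0 = 0.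
  move=> zi iC; apply: (subsuppP _ _ z'v); rewrite in_supp !mxE zi.
  have -> : w i 0 = 0; last by rewrite mulr0 subrr eqxx.
  by apply: (subsuppP _ _ wCz); rewrite inE negb_or iC in_supp zi eqxx.
have z'h : z' h 0 = 0.
  by apply: (subsuppP _ _ z'v); rewrite in_supp !mxE divfK // subrr eqxx.
have z'C i : i \in C -> z' i 0 = 0.
  move=> iC; apply/eqP/negPn/negP => z'i.
  have := zmin _ _ _ ez' iC z'i eD z'e; rewrite leqNgt => /negP; apply.
  apply: proper_card; apply/properP; split.
    apply/subsetP => j; rewrite !inE negb_or => /andP[/andP[jC ->]].
    by rewrite jC /=; apply: contra_neq => /vout; apply.
  by exists h; rewrite !inE ?negb_or ?hC ?hD // z'h eqxx.
have [z'0 Vz' _] := ez'.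
have /negP := zel _ z'0 Vz'; apply; apply/properP; split.
  apply/subsuppP => i; rewrite in_supp negbK => /eqP zi.
  by have [/z'C//|iC] := boolP (i \in C); apply: vout.
by exists c; rewrite in_supp // z'C // eqxx.
Qed.

(* Take a circuit [z] meeting both circuits in as few elements as possible
   outside them. Subtracting multiples of [x] and [y] from [z] so as to cancel
   [z] on different parts of their supports gives [u1] and [u2]. *)
Lemma skew_circuits V S x y : subspace V -> (forall v, V v -> supp v \subset S) ->
  (forall P, closed_under_proj V P -> [disjoint P & S] \/ S \subset P) ->
  elementary V x -> elementary V y -> [disjoint supp x & supp y] ->
  (forall w, V w -> supp w \subset supp x :|: supp y ->
     exists a b, w = a *: x + b *: y) ->
  exists u1 u2, [/\ elementary V u1, elementary V u2 &
    (#|supp x| + #|supp y| < #|supp u1| + #|supp u2|)%N].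
Proof.
move=> sV VS conn ex ey dxy skew.
set C := supp x; set D := supp y.
have xD i : i \in D -> x i 0 = 0.
  by move=> iD; apply/eqP; rewrite -[_ == _]negbK -in_supp (disjointFl dxy iD).
have yC i : i \in C -> y i 0 = 0.
  by move=> iC; apply/eqP; rewrite -[_ == _]negbK -in_supp (disjointFr dxy iC).
have [x0 Vx _] := ex; have [y0 Vy _] := ey.
have [c xc] := col_neq0P _ x0; have [f yf] := col_neq0P _ y0.
(* Connectivity enters here: the class of [c] meets [S], hence contains it. *)
have lnk : linked V c f.
  have [dis|sub] := conn _ (linked_closed c sV).
    have cS : c \in S by apply: (subsetP (VS _ Vx)); rewrite in_supp.
    by have := disjointFl dis cS; rewrite inE => /asboolPn []; exists x.
  have := subsetP sub f; rewrite inE => h; apply/asboolP/h.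
  by apply: (subsetP (VS _ Vy)); rewrite in_supp.
have [z [ez [c' [e [cC zc eD ze]]] zmin]] : exists z, [/\ elementary V z,
    exists c e, [/\ c \in C, z c 0 != 0, e \in D & z e 0 != 0] &
  forall z2 c2 e2, elementary V z2 -> c2 \in C -> z2 c2 0 != 0 ->
     e2 \in D -> z2 e2 0 != 0 ->
     (#|supp z :\: (C :|: D)| <= #|supp z2 :\: (C :|: D)|)%N].
  have [|z [[ez hz] zmin]] := @exists_min _ (fun z => elementary V z /\
    exists c e, [/\ c \in C, z c 0 != 0, e \in D & z e 0 != 0])
    (fun z => #|supp z :\: (C :|: D)|).
    case: lnk => z [ez zc ze]; exists z; split=> //; exists c, f.
    by rewrite !in_supp.
  exists z; split=> // z2 c2 e2 ez2 c2C z2c e2D z2e; apply: zmin; split=> //.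
  by exists c2, e2.
have [_ Vz zel] := ez.
have notall (v : 'cV[K]_n) j : elementary V v -> v j 0 = 0 -> z j 0 != 0 ->
    exists i, v i 0 != 0 /\ z i 0 = 0.
  move=> ev vj zj; have [v0 Vv _] := ev; apply: contrapT => no.
  have [|a va] := @elementary_prop _ _ V z v sV ez Vv.
    apply/subsuppP=> i; rewrite in_supp negbK => /eqP zi.
    by apply/eqP/negPn/negP => vi; apply: no; exists i.
  move: v0; move: vj; rewrite va mxE => /eqP; rewrite mulf_eq0 (negPf zj) orbF.
  by move/eqP ->; rewrite scale0r eqxx.
have [i0 [xi0 zi0]] := notall x e ex (xD _ eD) ze.
have [j0 [yj0 zj0]] := notall y c' ey (yC _ cC) zc.
(* A [z] inside [C :|: D] would be a combination of [x] and [y]; vanishing at [i0], it could not be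
   nonzero at [c']. *)
have [g [gC gD zg]] : exists g, [/\ g \notin C, g \notin D & z g 0 != 0].
  apply: contrapT => no.
  have [|a [b zab]] := skew z Vz.
    apply/subsuppP => i; rewrite inE negb_or => /andP[iC iD].
    by apply/eqP/negPn/negP => zi; apply: no; exists i.
  move: zi0 zc; rewrite zab !mxE (yC c') // (yC i0) ?in_supp // !mulr0 !addr0.
  by move/eqP; rewrite mulf_eq0 (negPf xi0) orbF => /eqP ->; rewrite mul0r eqxx.
(* Outside [C :|: D] the vector [z] is thus minimal. A circuit [w1] through [h] that avoids [g]
   either meets both [C] and [D], against the choice of [z], or misses one of them, which
   [linking_one_sided] excludes. *)
have Fmin w : V w -> supp w \subset C :|: D :|: supp z -> w g 0 = 0 ->
    forall h, h \notin C -> h \notin D -> w h 0 = 0.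
  move=> Vw wsub wg h hC hD; apply/eqP/negPn/negP => wh.
  have [w1 [ew1 w1w w1h]] := elementary_through sV Vw wh.
  have w1sub := subset_trans w1w wsub.
  have Vw1 : V w1 by case: ew1.
  have w1g : w1 g 0 = 0 by apply: (subsuppP _ _ w1w); rewrite in_supp wg eqxx.
  have [[i [iC w1i]]|nC] := pselect (exists i, i \in C /\ w1 i 0 != 0); last first.
    have w1C i : i \in C -> w1 i 0 = 0.
      by move=> iC; apply/eqP/negPn/negP => w1i; apply: nC; exists i.
    move: w1h; rewrite (@linking_one_sided V D C z w1 e c' h) ?eqxx //.
    - by rewrite (disjointFl dxy eD).
    - move=> z2 c2 e2 ez2 c2D z2c e2C z2e; rewrite setUC.
      exact: (zmin z2 e2 c2).
    apply/subsuppP => i; rewrite inE negb_or => /andP[iD iz].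
    have [/w1C//|iC] := boolP (i \in C).
    by apply: (subsuppP _ _ w1sub); rewrite !in_setU !negb_or iC iD.
  have [[j [jD w1j]]|nD] := pselect (exists j, j \in D /\ w1 j 0 != 0); last first.
    have w1D j : j \in D -> w1 j 0 = 0.
      by move=> jD; apply/eqP/negPn/negP => w1j; apply: nD; exists j.
    move: w1h; rewrite (@linking_one_sided V C D z w1 c' e h) ?eqxx //.
      by rewrite (disjointFr dxy cC).
    apply/subsuppP => k; rewrite inE negb_or => /andP[kC kz].
    have [/w1D//|kD] := boolP (k \in D).
    by apply: (subsuppP _ _ w1sub); rewrite !in_setU !negb_or kC kD.
  have := zmin w1 i j ew1 iC w1i jD w1j; rewrite leqNgt => /negP; apply.
  apply: proper_card; apply/properP; split.
    apply/subsetP => k; rewrite in_setD in_setU negb_or => /andP[/andP[kC kD] kw].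
    have := subsetP w1sub _ kw.
    by rewrite in_setD !in_setU negb_or (negPf kC) (negPf kD).
  exists g; first by rewrite in_setD in_setU negb_or gC gD in_supp.
  by rewrite in_setD in_supp w1g eqxx andbF.
(* One zero in each of [C] and [D] suffices: a vector supported in [supp u] becomes, once cancelled
   at [g], a combination of [x] and [y], and these zeros kill both coefficients. *)
have elem a b i j : i \in C -> j \in D -> z i 0 = a * x i 0 -> z j 0 = b * y j 0 ->
    elementary V (z - a *: x - b *: y).
  move=> iC jD zi zj; set u := z - _ - _.
  have Vu : V u by apply: subspaceBZ => //; apply: subspaceBZ.
  have outx k : k \notin C -> x k 0 = 0.
    by rewrite in_supp negbK => /eqP.
  have outy k : k \notin D -> y k 0 = 0.
    by rewrite in_supp negbK => /eqP.
  have ug : u g 0 != 0 by rewrite !mxE outx // outy // !mulr0 !subr0.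
  have usub : supp u \subset C :|: D :|: supp z.
    apply/subsuppP => k; rewrite !in_setU !negb_or => /andP[/andP[kC kD]].
    by rewrite in_supp negbK => /eqP zk; rewrite !mxE outx // outy // zk !mulr0 !subr0.
  apply: elementaryI => //; first by apply/col_neq0P; exists g.
  move=> w Vw wu; exists (w g 0 / u g 0).
  pose v : 'cV[K]_n := w - (w g 0 / u g 0) *: u.
  have Vv : V v by apply: subspaceBZ.
  have vu : supp v \subset supp u.
    apply/subsuppP => k ku; rewrite !mxE (subsuppP _ _ wu _ ku).
    by move: ku; rewrite in_supp negbK !mxE => /eqP ->; rewrite mulr0 subr0.
  have vg : v g 0 = 0 by rewrite /v 2!mxE [X in _ - X]mxE divfK // subrr.
  have vF := Fmin v Vv (subset_trans vu usub) vg.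
  have [|p [q vpq]] := skew v Vv.
    by apply/subsuppP => k; rewrite inE negb_or => /andP[]; apply: vF.
  have vi : v i 0 = 0.
    by apply: (subsuppP _ _ vu); rewrite in_supp !mxE zi yC // mulr0 subr0 subrr eqxx.
  have vj : v j 0 = 0.
    by apply: (subsuppP _ _ vu); rewrite in_supp !mxE zj xD // mulr0 subr0 subrr eqxx.
  have p0 : p = 0.
    move/eqP: vi; rewrite vpq !mxE yC // mulr0 addr0 mulf_eq0.
    by move: iC; rewrite in_supp => /negPf ->; rewrite orbF => /eqP.
  have q0 : q = 0.
    move/eqP: vj; rewrite vpq !mxE xD // mulr0 add0r mulf_eq0.
    by move: jD; rewrite in_supp => /negPf ->; rewrite orbF => /eqP.
  by apply/eqP; rewrite -subr_eq0 -/v vpq p0 q0 !scale0r addr0.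
have xc' : x c' 0 != 0 by rewrite -in_supp.
have ye : y e 0 != 0 by rewrite -in_supp.
pose a := z c' 0 / x c' 0; pose b := z e 0 / y e 0.
have a0 : a != 0 by rewrite mulf_neq0 // invr_eq0.
have b0 : b != 0 by rewrite mulf_neq0 // invr_eq0.
(* [z] itself vanishes at [i0] and [j0]; the second circuit is cancelled at [c'] and [e]. Both
   contain [g], and as [a] and [b] are nonzero they jointly cover [C :|: D]. *)
exists (z - 0 *: x - 0 *: y), (z - a *: x - b *: y); split.
- by apply: (elem 0 0 i0 j0) => //; rewrite ?in_supp // mul0r.
- by apply: (elem a b c' e) => //; rewrite divfK.
rewrite !scale0r !subr0; set u := z - _ - _.
rewrite -(cardsUI (supp z)).
have -> : (#|C| + #|D| = #|C :|: D|)%N.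
  by rewrite cardsU (_ : C :&: D = set0) ?cards0 ?subn0 //; apply/eqP; rewrite setI_eq0.
have h1 : (0 < #|supp z :&: supp u|)%N.
  apply/card_gt0P; exists g; rewrite inE !in_supp zg /=.
  move: gC gD; rewrite !in_supp !negbK !mxE => /eqP -> /eqP ->.
  by rewrite !mulr0 !subr0.
have h2 : (#|C :|: D| <= #|supp z :|: supp u|)%N.
  apply: subset_leq_card; apply/subsetP => k; rewrite in_setU.
  have [kC _|kC /= kD] := boolP (k \in C).
    rewrite !inE; have [zk|//] := eqVneq (z k 0) 0; rewrite /=.
    by rewrite !mxE zk yC // mulr0 subr0 sub0r oppr_eq0 mulf_neq0 // -in_supp.
  rewrite !inE; have [zk|//] := eqVneq (z k 0) 0; rewrite /=.
  by rewrite !mxE zk xD // mulr0 subr0 sub0r oppr_eq0 mulf_neq0 // -in_supp.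
by rewrite -addn1 leq_add.
Qed.

(** Let [v] lift [y]. If [v] is not proportional to [x] on [supp x], two distinct ratios [a], [b]
    give circuits [v - a *: x] and [v - b *: x] that share [supp y] and jointly cover
    [supp x :|: supp y], so [y] has at most half the size of [x]. Otherwise [y] lies in [V], and if
    it were as large as [x], [skew_circuits] would give a circuit larger than [x]. *)
Lemma contract_circuit_lt V S x y : subspace V ->
  (forall v, V v -> supp v \subset S) ->
  (forall P, closed_under_proj V P -> [disjoint P & S] \/ S \subset P) ->
  elementary V x -> (forall z, elementary V z -> (#|supp z| <= #|supp x|)%N) ->
  elementary (contract V (supp x)) y -> (#|supp y| < #|supp x|)%N.
Proof.
move=> sV VS conn ex xmax ey; set C := supp x.
have [y0 [v Vv yv] _] := ey; have [x0 Vx _] := ex.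
have sV' := contract_subspace C sV.
have outx k : k \notin C -> x k 0 = 0 by rewrite in_supp negbK => /eqP.
have yC i : i \in C -> y i 0 = 0 by move=> iC; rewrite yv projE inE iC.
have yE i : i \notin C -> y i 0 = v i 0 by move=> iC; rewrite yv projE inE iC.
have over (w : 'cV[K]_n) : V w -> supp w \subset C :|: supp y ->
    exists a b, w = a *: x + b *: v.
  move=> Vw wsub.
  have [||b wb] := @elementary_prop _ _ _ y (proj (~: C) w) sV' ey.
  - by exists w.
  - apply/subsuppP=> i iy; rewrite projE inE; case: ifP => // /negP/negP iC.
    by apply: (subsuppP _ _ wsub); rewrite inE negb_or iC.
  have [||a wa] := @elementary_prop _ _ _ x (w - b *: v) sV ex; first exact: subspaceBZ.
    apply/subsuppP=> i iC; move/matrixP/(_ i 0): wb; rewrite !mxE inE iC yE //.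
    by move=> ->; rewrite subrr.
  by exists a, b; rewrite -wa subrK.
have elem a : (supp (v - a *: x) \subset supp y) \/ (exists2 i, i \in C & v i 0 = a * x i 0) ->
  elementary V (v - a *: x).
  move=> h; have Vu : V (v - a *: x) by apply: subspaceBZ.
  have uy i : i \notin C -> (v - a *: x) i 0 = y i 0.
    by move=> iC; rewrite !mxE outx // yE // mulr0 subr0.
  have yne : exists2 i, i \notin C & y i 0 != 0.
    by have [i yi] := col_neq0P _ y0; exists i => //; apply: contra yi => /yC ->.
  have usub : supp (v - a *: x) \subset C :|: supp y.
    apply/subsuppP=> i; rewrite inE negb_or => /andP[iC]; rewrite in_supp negbK.
    by move/eqP => yi; rewrite uy.
  have [i iC ui] : exists2 i, i \in C & (v - a *: x) i 0 = 0.
    case: h => [h|[i iC vi]]; last by exists i => //; rewrite !mxE vi subrr.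
    have [i xi] := col_neq0P _ x0; have iC : i \in C by rewrite in_supp.
    by exists i => //; apply: (subsuppP _ _ h); rewrite in_supp yC // eqxx.
  apply: elementaryI => //.
    by have [j jC yj] := yne; apply/col_neq0P; exists j; rewrite uy.
  move=> w Vw wu; have [p [q wpq]] := over _ Vw (subset_trans wu usub).
  exists q; have wi : w i 0 = 0 by apply: (subsuppP _ _ wu); rewrite in_supp ui eqxx.
  have -> : w = (p + q * a) *: x + q *: (v - a *: x).
    by rewrite wpq; apply: col_eqP=> k; rewrite !mxE; ring.
  move: wi; have -> : w = (p + q * a) *: x + q *: (v - a *: x).
    by rewrite wpq; apply: col_eqP=> k; rewrite !mxE; ring.
  rewrite mxE [X in _ + X]mxE ui mulr0 addr0 mxE => /eqP; rewrite mulf_eq0.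
  by move: (iC); rewrite in_supp => /negPf ->; rewrite orbF => /eqP ->; rewrite scale0r add0r.
have suppu a : supp y \subset supp (v - a *: x).
  apply/subsetP=> i; rewrite !in_supp => yi.
  have iC : i \notin C by apply: contra yi => /yC ->.
  by rewrite !mxE outx // mulr0 subr0 -yE.
have dCy : C :&: supp y = set0.
  by apply/setP=> i; rewrite in_setI in_set0; have [iC|//] := boolP (i \in C); rewrite in_supp yC // eqxx.
have Cy : (#|C :|: supp y| = #|C| + #|supp y|)%N by rewrite cardsU dCy cards0 subn0.
have C0 : (0 < #|C|)%N.
  by have [i xi] := col_neq0P _ x0; apply/card_gt0P; exists i; rewrite in_supp.
have [i xi] := col_neq0P _ x0; have iC : i \in C by rewrite in_supp.
pose a := v i 0 / x i 0.
have ea : elementary V (v - a *: x).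
  by apply: elem; right; exists i => //; rewrite divfK.
have [[j [jC vj]]|con] := pselect (exists j, j \in C /\ v j 0 <> a * x j 0).
  have xj : x j 0 != 0 by rewrite -in_supp.
  pose b := v j 0 / x j 0.
  have eb : elementary V (v - b *: x).
    by apply: elem; right; exists j => //; rewrite divfK.
  have ab : a != b by apply/eqP => ab; apply: vj; rewrite ab divfK.
  have := leq_add (xmax _ ea) (xmax _ eb); rewrite -cardsUI.
  have h1 : (#|supp y| <= #|supp (v - a *: x) :&: supp (v - b *: x)|)%N.
    by apply: subset_leq_card; rewrite subsetI !suppu.
  have h2 : (#|C :|: supp y| <= #|supp (v - a *: x) :|: supp (v - b *: x)|)%N.
    apply: subset_leq_card; rewrite subUset; apply/andP; split; last first.
      by apply: subset_trans (suppu a) _; apply: subsetUl.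
    apply/subsetP=> k kC; have xk : x k 0 != 0 by rewrite -in_supp.
    rewrite !inE !mxE -negb_and; apply/negP => /andP[].
    rewrite !subr_eq0 => /eqP -> /eqP /(mulIf xk) /eqP; exact/negP.
  move: h1 h2; rewrite Cy -/C; move: #|_ :&: _| #|_ :|: _| C0; clear => p q; lia.
have {con} vC j : j \in C -> v j 0 = a * x j 0.
  by move=> jC; apply: contrapT => vj; apply: con; exists j.
have yva : y = v - a *: x.
  apply: col_eqP=> k; rewrite !mxE; have [kC|kC] := boolP (k \in C).
    by rewrite yC // vC // subrr.
  by rewrite yE // outx // mulr0 subr0.
rewrite ltnNge; apply/negP => Cley.
have [|||u1 [u2 [e1 e2]]] := @skew_circuits V S x y sV VS conn ex; rewrite ?yva //.
  - by rewrite -yva disjoints_subset; apply/subsetP => k kC; rewrite inE in_supp yC // eqxx.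
  - rewrite -yva => w Vw wsub; have [p [q wpq]] := over w Vw wsub.
    exists (p + q * a), q; rewrite wpq; apply: col_eqP=> k.
    by rewrite yva !mxE; ring.
rewrite -yva ltnNge => /negP; apply.
apply: leq_trans (leq_add (xmax _ e1) (xmax _ e2)) _.
by rewrite leq_add2l.
Qed.

End LongCircuits.

(** * Inductive bounds on tree-depth *)

(** Bounds the tree-depth of the subgraph induced on [R]. The relation is in [Prop] because
    [basis_adj] quantifies over vectors. *)
Inductive td_le (T : finType) (e : T -> T -> Prop) : nat -> {set T} -> Prop :=
| td_le0 d : td_le e d set0
| td_le_add d r (R : {set T}) : r \notin R -> td_le e d R -> td_le e d.+1 (r |: R)
| td_le_union d (R1 R2 : {set T}) : [disjoint R1 & R2] ->
    (forall x y, x \in R1 -> y \in R2 -> ~ e x y /\ ~ e y x) ->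
    td_le e d R1 -> td_le e d R2 -> td_le e d (R1 :|: R2).

Section TreeDepthBounds.
Context (T : finType) (e : T -> T -> Prop).
Implicit Types (R S : {set T}) (d : nat).

Lemma td_le_leq d d' R : td_le e d R -> (d <= d')%N -> td_le e d' R.
Proof.
move=> h; elim: h d' => {d R} [d|d r R rR _ IH|d R1 R2 dis no _ IH1 _ IH2] d' dd'.
- exact: td_le0.
- by case: d' dd' => // d' dd'; apply: td_le_add rR (IH _ dd').
- by apply: td_le_union dis no (IH1 _ dd') (IH2 _ dd').
Qed.

Lemma td_le_image (T' : finType) (e' : T' -> T' -> Prop) (f : T -> T') d R :
  td_le e d R -> {in R &, injective f} ->
  (forall x y, x \in R -> y \in R -> e' (f x) (f y) -> e x y) ->
  td_le e' d (f @: R).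
Proof.
elim=> {d R} [d|d r R rR _ IH|d R1 R2 dis no _ IH1 _ IH2] finj he.
- by rewrite imset0; apply: td_le0.
- rewrite imsetU1; apply: td_le_add.
    apply: contra rR => /imsetP[x xR /finj ->] //; first exact: setU11.
    exact: setU1r.
  apply: IH => [x y xR yR|x y xR yR]; first by apply: finj; apply: setU1r.
  by apply: he; apply: setU1r.
have i1 x : x \in R1 -> x \in R1 :|: R2 by rewrite inE => ->.
have i2 x : x \in R2 -> x \in R1 :|: R2 by rewrite inE => ->; rewrite orbT.
rewrite imsetU; apply: td_le_union.
- apply/pred0P => y /=; apply/negP => /andP[/imsetP[x1 x1R ->] /imsetP[x2 x2R]].
  by move=> /(finj _ _ (i1 _ x1R) (i2 _ x2R)) x12; move: x2R; rewrite -x12 (disjointFr dis).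
- move=> _ _ /imsetP[x xR ->] /imsetP[y yR ->]; have [n1 n2] := no _ _ xR yR.
  by split=> h; [apply: n1 | apply: n2]; apply: he h; auto.
- by apply: IH1 => [x y xR yR|x y xR yR]; [apply: finj | apply: he]; auto.
- by apply: IH2 => [x y xR yR|x y xR yR]; [apply: finj | apply: he]; auto.
Qed.

Lemma td_le_edgeless R : (forall x y, x \in R -> y \in R -> x != y -> ~ e x y) ->
  td_le e 1 R.
Proof.
have [k] := ubnP #|R|; elim: k R => // k IH R; rewrite ltnS => lek no.
have [->|[r rR]] := set_0Vmem R; first exact: td_le0.
rewrite -(setD1K rR); apply: td_le_union.
- by rewrite disjoint_sym disjoints_subset; apply/subsetP => x; rewrite !inE => /andP[].
- move=> x y; rewrite inE => /eqP -> ; rewrite !inE => /andP[yr yR].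
  by split; apply: no; rewrite // eq_sym.
- rewrite -[[set r]]setU0; apply: td_le_add; [by rewrite inE | exact: td_le0].
- apply: IH; first by rewrite (cardsD1 r) rR in lek.
  by move=> x y; rewrite !inE => /andP[_ xR] /andP[_ yR]; apply: no.
Qed.

Lemma td_le_addset d R S : td_le e d R -> [disjoint S & R] ->
  td_le e (#|S| + d) (S :|: R).
Proof.
move=> h; have [k] := ubnP #|S|; elim: k S => // k IH S; rewrite ltnS => lek dis.
have [->|[r rS]] := set_0Vmem S; first by rewrite cards0 set0U.
rewrite -(setD1K rS) -setUA cardsU1 !inE eqxx /= add1n; apply: td_le_add.
  by rewrite !inE eqxx (disjointFr dis rS).
apply: IH; first by rewrite (cardsD1 r) rS in lek.
by apply: disjointWl dis; apply: subD1set.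
Qed.

End TreeDepthBounds.

Lemma td_le_sub (T : finType) (e e' : T -> T -> Prop) d R : td_le e d R ->
  (forall x y, x \in R -> y \in R -> e' x y -> e x y) -> td_le e' d R.
Proof. by move=> h he; rewrite -[R]imset_id; apply: td_le_image h _ _. Qed.

(** * Bases of small dual tree-depth *)

Section Bases.
Context (K : fieldType) (n : nat).
Implicit Types (V : 'cV[K]_n -> Prop) (B P S : {set 'I_n}).

Definition basis V S B :=
  [/\ B \subset S, (forall v, V v -> supp v \subset B -> v = 0) &
    forall e, e \in S -> e \notin B -> exists y, [/\ V y, y e 0 = 1 &
      forall j, j \in S -> j \notin B -> j != e -> y j 0 = 0]].

(* When [y] is supported in [B] and one further element [e], it is a multiple of
   the fundamental circuit of [e], that is, of a column of the reduced row
   echelon form: [basis_adj] is the dual graph of that form. *)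
Definition basis_adj V S B b b' := exists (y : 'cV[K]_n) e,
  [/\ V y, (forall j, j \in S -> j \notin B -> j != e -> y j 0 = 0),
   y b 0 != 0 & y b' 0 != 0].

Lemma supported_subspace V P : subspace V -> subspace (fun v => V v /\ supp v \subset P).
Proof.
case=> V0 VD; split; first by split=> //; apply/subsuppP => i _; rewrite mxE.
move=> a u v [Vu /subsuppP uP] [Vv /subsuppP vP]; split; first exact: VD.
by apply/subsuppP => i iP; rewrite !mxE uP // vP // mulr0 addr0.
Qed.

(** Adjacency is witnessed by vectors, and witnesses can be projected: edges within a component, or
    outside the contracted circuit, are edges of the smaller problem and are covered by its
    forest. *)
Lemma exists_shallow_basis V S k : subspace V ->
  (forall v, V v -> supp v \subset S) ->
  (forall x, elementary V x -> (#|supp x| <= k)%N) ->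
  exists2 B, basis V S B & td_le (basis_adj V S B) (k * k.-1).+1 B.
Proof.
have [N] := ubnP #|S|; elim: N V S k => // N IH V S k; rewrite ltnS => leN sV VS Vk.
have [V0|nV0] := pselect (forall v, V v -> v = 0).
  exists S; first by split=> //; [move=> v /V0 | move=> e ->].
  apply: (@td_le_leq _ _ 1) => //; apply: td_le_edgeless => x y _ _ _ [v [e [Vv _]]].
  by rewrite (V0 _ Vv) mxE eqxx.
have [[P [Pcl PS SP]]|conn] := pselect (exists P : {set 'I_n}, [/\ closed_under_proj V P,
    ~~ [disjoint P & S] & ~~ (S \subset P)]).
  pose part (Q : {set 'I_n}) := fun v : 'cV[K]_n => V v /\ supp v \subset Q.
  have part_basis (Q : {set 'I_n}) : (#|S :&: Q| < #|S|)%N ->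
    exists2 B, basis (part (S :&: Q)) (S :&: Q) B &
      td_le (basis_adj (part (S :&: Q)) (S :&: Q) B) (k * k.-1).+1 B.
    move=> lt; apply: IH; first exact: leq_trans lt leN.
    - exact: supported_subspace.
    - by move=> v [].
    move=> x [x0 [Vx xQ] xmin]; apply: Vk; split=> // y y0 Vy.
    apply/negP => yx; suff /xmin : part (S :&: Q) y by move=> /(_ y0); rewrite yx.
    split=> //.
    exact: subset_trans (proper_sub yx) xQ.
  have Pcl' : closed_under_proj V (~: P).
    move=> v Vv; rewrite (_ : proj _ v = v - 1 *: proj P v).
      by apply: subspaceBZ => //; apply: Pcl.
    by apply: col_eqP=> i; rewrite !mxE inE; case: (i \in P) => /=; rewrite mul1r ?subr0 ?subrr.
  have prt (v : 'cV[K]_n) (Q : {set 'I_n}) :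
    closed_under_proj V Q -> V v -> part (S :&: Q) (proj Q v).
    move=> Qcl Vv; split; first exact: Qcl.
    apply/subsuppP => i; rewrite inE negb_and projE => /orP[iS|/negPf -> //].
    by case: ifP => // _; apply: (subsuppP _ _ (VS _ Vv)).
  have [|B1 [B1S B1i B1s] td1] := part_basis P.
    apply: proper_card; apply/properP; split; first exact: subsetIl.
    by have /subsetPn[x xS xP] := SP; exists x => //; rewrite inE xS.
  have [|B2 [B2S B2i B2s] td2] := part_basis (~: P).
    apply: proper_card; apply/properP; split; first exact: subsetIl.
    move: PS; rewrite disjoint_sym disjoints_subset => /subsetPn[x xS xP].
    by exists x => //; rewrite inE xS.
  have B1P i : i \in B1 -> i \in P by move/(subsetP B1S); rewrite inE => /andP[].
  have B2P i : i \in B2 -> i \notin P by move/(subsetP B2S); rewrite !inE => /andP[].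
  have BS : B1 :|: B2 \subset S.
    by rewrite subUset (subset_trans B1S (subsetIl _ _)) (subset_trans B2S (subsetIl _ _)).
  have inB i : i \in B1 :|: B2 = if i \in P then i \in B1 else i \in B2.
    rewrite inE; case: ifP => iP; last by have [/B1P|] := boolP (i \in B1); rewrite ?iP.
    by have [/B2P|] := boolP (i \in B2); rewrite ?iP // orbF.
  have proj0_1 (v : 'cV[K]_n) : V v ->
    (forall j, j \in S -> j \in P -> j \notin B1 -> v j 0 = 0) -> proj P v = 0.
    move=> Vv h; apply: B1i; first exact: prt.
    apply/subsuppP => i iB; rewrite projE; case: ifP => // iP.
    have [iS|iS] := boolP (i \in S); first exact: h.
    exact: (subsuppP _ _ (VS _ Vv)).
  have proj0_2 (v : 'cV[K]_n) : V v ->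
    (forall j, j \in S -> j \notin P -> j \notin B2 -> v j 0 = 0) -> proj (~: P) v = 0.
    move=> Vv h; apply: B2i; first exact: prt.
    apply/subsuppP => i iB; rewrite projE inE; case: ifP => // iP.
    have [iS|iS] := boolP (i \in S); first exact: h.
    exact: (subsuppP _ _ (VS _ Vv)).
  have zero1 (v : 'cV[K]_n) i : proj P v = 0 -> i \in P -> v i 0 = 0.
    by move/matrixP/(_ i 0); rewrite !mxE => + iP; rewrite iP.
  have zero2 (v : 'cV[K]_n) i : proj (~: P) v = 0 -> i \notin P -> v i 0 = 0.
    by move/matrixP/(_ i 0); rewrite !mxE inE => + iP; rewrite iP.
  exists (B1 :|: B2).
    split=> // [v Vv vB|e eS].
      have v1 := proj0_1 v Vv; have v2 := proj0_2 v Vv.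
      apply: col_eqP=> i; rewrite mxE; have [iP|iP] := boolP (i \in P).
        apply: zero1 iP; apply: v1 => j jS jP jB; apply: (subsuppP _ _ vB).
        by rewrite inB jP.
      apply: zero2 iP; apply: v2 => j jS jP jB; apply: (subsuppP _ _ vB).
      by rewrite inB (negPf jP).
    rewrite inB; case: ifP => eP eB.
      have [|y [[Vy yP] ye ys]] := B1s e _ eB; first by rewrite inE eS.
      exists y; split=> // j jS; rewrite inB; case: ifP => jP jB je.
        by apply: ys => //; rewrite inE jS.
      by apply: (subsuppP _ _ yP); rewrite inE jP andbF.
    have [|y [[Vy yP] ye ys]] := B2s e _ eB; first by rewrite !inE eS eP.
    exists y; split=> // j jS; rewrite inB; case: ifP => jP jB je.
      by apply: (subsuppP _ _ yP); rewrite !inE jP andbF.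
    by apply: ys => //; rewrite !inE jS jP.
  (* A witness with at most one element [e] of [S] outside the basis projects to [0] on the side not
     containing [e], by independence there. *)
  have no (x y : 'I_n) : x \in B1 -> y \in B2 -> forall v e, V v ->
      (forall j, j \in S -> j \notin B1 :|: B2 -> j != e -> v j 0 = 0) ->
      v x 0 != 0 -> v y 0 != 0 -> False.
    move=> xB yB v e Vv ve vx vy; have [eP|eP] := boolP (e \in P).
      move: vy; rewrite (zero2 v) ?eqxx //; last exact: B2P.
      apply: proj0_2 => // j jS jP jB; apply: ve; rewrite // ?inB ?(negPf jP) //.
      by apply: contraNneq jP => ->.
    move: vx; rewrite (zero1 v) ?eqxx //; last exact: B1P.
    apply: proj0_1 => // j jS jP jB; apply: ve; rewrite // ?inB ?jP //.
    by apply: contraTneq jP => ->.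
  apply: td_le_union.
  - by rewrite disjoints_subset; apply/subsetP => i /B1P; rewrite inE; apply: contraL => /B2P.
  - move=> x y xB yB; split=> -[v [e [Vv ve v1 v2]]]; [exact: (no x y xB yB v e)|].
    exact: (no x y xB yB v e).
  - apply: (td_le_sub td1) => x y xB yB [v [e [Vv ve vx vy]]].
    exists (proj P v), e; rewrite !projE !B1P //; split=> //; first exact: prt.
    move=> j; rewrite inE projE => /andP[jS jP] jB je; rewrite jP.
    by apply: ve; rewrite // inB jP.
  - apply: (td_le_sub td2) => x y xB yB [v [e [Vv ve vx vy]]].
    exists (proj (~: P) v), e; rewrite !projE !inE !B2P //; split=> //; first exact: prt.
    move=> j; rewrite !inE projE inE => /andP[jS jP] jB je; rewrite jP.
    by apply: ve; rewrite // inB (negPf jP).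
have {}conn P : closed_under_proj V P -> [disjoint P & S] \/ S \subset P.
  move=> Pcl; apply: contrapT => h; apply: conn; exists P; split=> //.
    by apply/negP => hh; apply: h; left.
  by apply/negP => hh; apply: h; right.
have [v0 [Vv0 v00]] : exists v : 'cV[K]_n, V v /\ v != 0.
  apply: contrapT => h; apply: nV0 => v Vv; apply/eqP/negPn/negP => v0.
  by apply: h; exists v.
have [i0 vi0] := col_neq0P _ v00.
have [z0 [ez0 _ _]] := elementary_through sV Vv0 vi0.
(* Minimising [k - #|supp z|] maximises the support, which [k] bounds. *)
have [x [ex xmin]] := exists_min (fun z : 'cV[K]_n => k - #|supp z|)%N (ex_intro _ z0 ez0).
have xmax (z : 'cV[K]_n) : elementary V z -> (#|supp z| <= #|supp x|)%N.
  by move=> ez; have := xmin z ez; have := Vk z ez; have := Vk x ex; lia.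
have [x0 Vx xel] := ex; have [c xc] := col_neq0P _ x0.
set C := supp x; have cC : c \in C by rewrite in_supp.
have CS : C \subset S by apply: VS.
pose T := C :\ c.
have cardT : #|C| = #|T|.+1 by rewrite (cardsD1 c) cC.
have [||v|y ey|B [BS Bi Bs] tdB] := IH (contract V C) (S :\: C) #|T|.
- apply: leq_trans leN; apply: proper_card; apply/properP; split; first exact: subsetDl.
  by exists c; [exact: (subsetP CS) | rewrite in_setD cC].
- exact: contract_subspace.
- move=> [u Vu ->]; apply/subsuppP => i; rewrite in_setD negb_and negbK projE in_setC.
  case/orP=> [-> //|iS]; case: ifP => // _; exact: (subsuppP _ _ (VS _ Vu)).
- by rewrite -ltnS -cardT; apply: (contract_circuit_lt sV VS conn ex xmax ey).
have BC i : i \in B -> i \notin C by move/(subsetP BS); rewrite in_setD => /andP[].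
have TC i : i \in T -> i \in C by rewrite in_setD1 => /andP[].
have outx i : i \notin C -> x i 0 = 0 by rewrite in_supp negbK => /eqP.
have inTB i : (i \in T :|: B) = if i \in C then i != c else i \in B.
  rewrite in_setU in_setD1; case: ifP => iC; last by rewrite andbF.
  by rewrite andbT; have [/BC|] := boolP (i \in B); rewrite ?iC ?orbF.
exists (T :|: B).
  split=> [|v Vv vB|e eS].
  - rewrite subUset (subset_trans (subD1set _ _) CS) /=.
    exact: subset_trans BS (subsetDl _ _).
  - have vC i : i \notin C -> v i 0 = 0.
      move=> iC; have /matrixP/(_ i 0) : proj (~: C) v = 0; last by rewrite !mxE in_setC iC.
      apply: Bi; first by exists v.
      apply/subsuppP => j jB; rewrite projE in_setC; case: ifP => // /negPf jC.
      by apply: (subsuppP _ _ vB); rewrite inTB jC.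
    apply/eqP/negPn/negP => vn0; have /negP := xel v vn0 Vv; apply.
    apply/properP; split; first by apply/subsuppP.
    by exists c => //; apply: contraTN vB => cv; apply/subsetPn; exists c; rewrite // inTB cC eqxx.
  rewrite inTB; case: ifP => eC.
    rewrite negbK => /eqP ->; exists ((x c 0)^-1 *: x); split.
    - by rewrite -[_ *: _]addr0; case: sV => V0 VD; apply: VD.
    - by rewrite mxE mulVf.
    move=> j jS; rewrite inTB mxE; case: ifP => jC; first by rewrite negbK => ->.
    by rewrite (outx j) ?jC // mulr0.
  move=> eB; have [|y [[v Vv yv] ye ys]] := Bs e _ eB; first by rewrite in_setD eC.
  (* The lift may be nonzero at [c], the one element of [C] left out of the basis; a multiple of [x]
     corrects this and changes nothing outside [C]. *)
  exists (v - (v c 0 / x c 0) *: x); split; first exact: subspaceBZ.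
    by rewrite !mxE [x e 0]outx ?eC // mulr0 subr0 -ye yv projE in_setC eC.
  move=> j jS; rewrite inTB !mxE; case: ifP => jC.
    by rewrite negbK => /eqP -> _; rewrite divfK // subrr.
  move=> jB je; rewrite [x j 0]outx ?jC // mulr0 subr0.
  by have := ys j; rewrite yv projE in_setD in_setC jC; apply.
have dTB : [disjoint T & B].
  by rewrite disjoints_subset; apply/subsetP => i /TC iC; rewrite in_setC; apply: contraL iC; apply: BC.
have := td_le_addset (e := basis_adj V S (T :|: B)) _ dTB.
move/(_ (#|T| * #|T|.-1).+1) => h; apply: (td_le_leq (h _)).
  apply: (td_le_sub tdB) => i j iB jB [v [e [Vv ve vi vj]]].
  exists (proj (~: C) v), e; rewrite !projE !in_setC !BC //; split=> //; first by exists v.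
  move=> l; rewrite in_setD projE in_setC => /andP[lC lS] lB le; rewrite lC.
  by apply: ve => //; rewrite inTB (negPf lC).
(* With [t = #|T| < k] the depth is [t + t * (t - 1) + 1 = t ^ 2 + 1], at most [k * (k - 1) + 1]. *)
have := Vk x ex; rewrite -/C cardT; case: k {Vk xmin} => // k; rewrite ltnS /= => tk.
rewrite addnS ltnS; apply: leq_trans (leq_mul (_ : #|T|.+1 <= k.+1)%N tk); rewrite ?ltnS //.
by case: #|T| => //= t; nia.
Qed.

End Bases.

(** * From inductive bounds to rooted forests *)

(** [anc x y] means that [y] is an ancestor of [x]. A new root or a disjoint union is a simple
    formula on ancestor orders, so parents are chosen only at the end. *)
Definition forest_order (T : finType) (e : T -> T -> Prop) d (R : {set T}) (anc : rel T) :=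
  [/\ [/\ reflexive anc, transitive anc & antisymmetric anc],
      forall x y z, anc x y -> anc x z -> anc y z || anc z y,
      forall x y, anc x y -> x != y -> (x \in R) && (y \in R),
      forall x, x \in R -> (#|[set y | anc x y]| <= d)%N &
      forall x y, x \in R -> y \in R -> e x y -> anc x y || anc y x].

Lemma td_le_forest_order (T : finType) (e : T -> T -> Prop) d R :
  (forall x, ~ e x x) -> td_le e d R -> exists anc, forest_order e d R anc.
Proof.
move=> irr; elim=> {d R} [d|d r R rR _ [anc [[rfl trn anti] chn sup crd cov]]|
  d R1 R2 dis no _ [a1 [[rfl1 trn1 anti1] chn1 sup1 crd1 cov1]]
                 _ [a2 [[rfl2 trn2 anti2] chn2 sup2 crd2 cov2]]].
- exists eq_op; split=> [|x y z /eqP -> /eqP ->|x y /eqP -> /eqP//|x|x y]; rewrite ?eqxx ?inE //.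
  by split=> [x|y x z /eqP -> /eqP ->|x y /andP[/eqP]].
- have out x y : anc x y -> x \notin R -> x = y.
    by move=> xy xR; apply: contraNeq xR => /(sup _ _ xy) /andP[].
  have out2 x y : anc x y -> y \notin R -> x = y.
    by move=> xy yR; apply: contraNeq yR => /(sup _ _ xy) /andP[].
  exists (fun x y => anc x y || (y == r) && (x \in R)); split.
  + split=> [x|y x z|x y]; first by rewrite rfl.
      case/orP=> [xy|/andP[/eqP -> xR]] /orP[yz|/andP[/eqP -> yR]].
      * by rewrite (trn _ _ _ xy yz).
      * by rewrite eqxx /=; have [->|/(sup _ _ xy) /andP[-> _]] := eqVneq x y; rewrite ?yR orbT.
      * by rewrite -(out _ _ yz rR) eqxx xR orbT.
      * by rewrite (negPf rR) in yR.
    case/andP=> /orP[xy|/andP[/eqP -> xR]] /orP[yx|/andP[/eqP xr yR]].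
    * by apply: anti; rewrite xy.
    * by rewrite xr in xy; have yr := out _ _ xy rR; rewrite xr yr.
    * by have := out _ _ yx rR.
    * by rewrite xr (negPf rR) in xR.
  + move=> x y z /orP[xy|/andP[/eqP -> xR]] /orP[xz|/andP[/eqP -> xR']].
    * by case/orP: (chn _ _ _ xy xz) => ->; rewrite ?orbT.
    * by have [<-|/(sup _ _ xy) /andP[_ ->]] := eqVneq x y; rewrite ?xR' eqxx ?orbT.
    * by have [<-|/(sup _ _ xz) /andP[_ ->]] := eqVneq x z; rewrite ?xR eqxx ?orbT.
    * by rewrite rfl.
  + move=> x y /orP[xy xny|/andP[/eqP -> xR] _]; last by rewrite !inE eqxx xR orbT.
    by have /andP[xR yR] := sup _ _ xy xny; rewrite !inE xR yR !orbT.
  + move=> x; rewrite !inE => /orP[/eqP ->|xR].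
      apply: leq_trans (_ : #|[set r]| <= _)%N; last by rewrite cards1.
      apply: subset_leq_card; apply/subsetP => y; rewrite !inE (negPf rR) andbF orbF.
      by move=> /out ->.
    apply: leq_trans (_ : #|r |: [set y | anc x y]| <= _)%N.
      apply: subset_leq_card; apply/subsetP => y.
      by rewrite !inE orbC => /orP[/andP[-> _]|->]; rewrite ?orbT.
    by rewrite cardsU1 -add1n leq_add ?leq_b1 ?crd.
  + move=> x y; rewrite !inE => /orP[/eqP ->|xR] /orP[/eqP ->|yR] exy.
    * by have := irr _ exy.
    * by rewrite eqxx yR !orbT.
    * by rewrite eqxx xR !orbT.
    * by case/orP: (cov _ _ xR yR exy) => ->; rewrite ?orbT.
have s1 x y : a1 x y -> x \in R2 -> x = y.
  by move=> xy xR; apply: contraTeq xR => /(sup1 _ _ xy) /andP[xR _]; rewrite (disjointFr dis xR).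
have s1' x y : a1 x y -> y \in R2 -> x = y.
  by move=> xy xR; apply: contraTeq xR => /(sup1 _ _ xy) /andP[_ xR]; rewrite (disjointFr dis xR).
have s2 x y : a2 x y -> x \notin R2 -> x = y.
  by move=> xy; apply: contraNeq => /(sup2 _ _ xy) /andP[].
have s2' x y : a2 x y -> y \notin R2 -> x = y.
  by move=> xy; apply: contraNeq => /(sup2 _ _ xy) /andP[].
have same1 x y : a1 x y -> (x \in R2) = (y \in R2).
  by move=> xy; apply/idP/idP => h; [rewrite -(s1 _ _ xy)|rewrite (s1' _ _ xy)].
have same2 x y : a2 x y -> (x \in R2) = (y \in R2).
  move=> xy; apply/idP/idP => h; apply/negPn/negP => h'.
    by have := h'; rewrite -(s2' _ _ xy h') h.
  by have := h'; rewrite (s2 _ _ xy h') h.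
pose a x y := if x \in R2 then a2 x y else a1 x y.
have same x y : a x y -> (x \in R2) = (y \in R2).
  by rewrite /a; case: ifP => xR h; rewrite -xR; [exact: same2 | exact: same1].
exists a; split.
- split=> [x|y x z|x y]; first by rewrite /a; case: ifP.
    move=> xy yz; have xyR := same _ _ xy; move: xy yz; rewrite /a -xyR.
    by case: ifP => _; [apply: trn2|apply: trn1].
  case/andP => xy yx; have xyR := same _ _ xy; move: xy yx; rewrite /a -xyR.
  by case: ifP => _ xy yx; [apply: anti2|apply: anti1]; rewrite xy.
- move=> x y z xy xz; have xyR := same _ _ xy; have xzR := same _ _ xz.
  move: xy xz; rewrite /a -xyR -xzR.
  by case: ifP => _; [apply: chn2 | apply: chn1].
- move=> x y; rewrite /a; case: ifP => _ xy xny; rewrite !inE.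
    by have /andP[-> ->] := sup2 _ _ xy xny; rewrite !orbT.
  by have /andP[-> ->] := sup1 _ _ xy xny.
- move=> x; rewrite inE /a; case: (boolP (x \in R2)) => [xR _|_ /orP[xR|//]]; first exact: crd2.
  exact: crd1.
move=> x y; rewrite !inE /a.
case: (boolP (x \in R2)) => [x2 _|x2]; case: (boolP (y \in R2)) => [y2|y2]; rewrite ?orbF.
- by move=> _; apply: cov2.
- by move=> y1 exy; have [_ []] := no _ _ y1 x2.
- by move=> x1 _ exy; have [[]] := no _ _ x1 y2.
- exact: cov1.
Qed.

Lemma bigmin_leq (I : eqType) (r : seq I) (P : pred I) (F : I -> nat) k i :
  i \in r -> P i -> (\big[minn/k]_(j <- r | P j) F j <= F i)%N.
Proof.
move=> + Pi; elim: r => // j r IH; rewrite inE big_cons => /orP[/eqP <-|ir].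
  by rewrite Pi geq_minl.
by case: ifP => _; [apply: leq_trans (geq_minr _ _) _ |]; apply: IH.
Qed.

(** The parent of [x] is its nearest proper ancestor; ancestors form a chain, so this is the proper
    ancestor with most ancestors, and following parents recovers the order. *)
Lemma td_le_tree_depth (T : finType) (e : rel T) d : irreflexive e ->
  td_le (fun x y => e x y) d [set: T] -> (tree_depth e <= d)%N.
Proof.
move=> irr /td_le_forest_order [x|anc [[rfl trn anti] chn _ crd cov]]; first by rewrite irr.
pose up x := [set y | anc x y].
pose F := [ffun x => [pick y | [&& y != x, anc x y &
  [forall z, (z != x) && anc x z ==> anc y z]]]].
have FP x y : F x = Some y -> [/\ y != x, anc x y & forall z, z != x -> anc x z -> anc y z].
  rewrite ffunE; case: pickP => // z /and3P[zx xz /forallP h] [<-]; split=> // t tx xt.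
  by apply: (implyP (h t)); rewrite tx.
have FE x y : y != x -> anc x y -> exists p, F x = Some p.
  move=> yx xy; rewrite ffunE; case: pickP => [p _|no]; first by exists p.
  have Pxy : (y != x) && anc x y by rewrite yx.
  have := no [arg max_(z > y | (z != x) && anc x z) #|up z|].
  case: arg_maxnP => // p /andP[px xp] pmax; rewrite px xp /= => /negP[].
  apply/forallP => z; apply/implyP => /andP[zx xz].
  case/orP: (chn _ _ _ xp xz) => // zp.
  have [<-|zp'] := eqVneq z p; first exact: rfl.
  have : (#|up z| <= #|up p|)%N by apply: pmax; rewrite zx.
  rewrite leqNgt => /negP[].
  apply: proper_card; apply/properP; split.
    by apply/subsetP => t; rewrite !inE; apply: trn.
  exists z; rewrite inE ?rfl //; apply: contra zp' => pz.
  by apply/eqP; apply: anti; rewrite zp.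
have up_lt x y : anc x y -> y != x -> (#|up y| < #|up x|)%N.
  move=> xy yx; apply: proper_card; apply/properP; split.
    by apply/subsetP => t; rewrite !inE; apply: trn.
  exists x; rewrite inE ?rfl //; apply: contra yx => yx.
  by apply/eqP; apply: anti; rewrite yx.
have ancE x y : ancestor F x y = anc x y.
  apply/idP/idP.
    case/connectP => p; elim: p x => [x _ -> //|z p IH x /= /andP[/eqP/FP[_ xz _] zp] yl].
    exact: trn xz (IH _ zp yl).
  have [k] := ubnP #|up x|; elim: k x => // k IH x; rewrite ltnS => lek xy.
  have [->|yx] := eqVneq y x; first exact: connect0.
  have [p xp] := FE _ _ yx xy; have [px xap ph] := FP _ _ xp.
  apply: connect_trans (connect1 _) (IH p _ _); first by rewrite /= xp.
    exact: leq_trans (up_lt _ _ xap px) lek.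
  exact: ph.
have fF : is_forest F.
  apply/forallP => x; apply/forallP => y; apply/implyP => /eqP /FP [yx xy _].
  by rewrite ancE; apply: contra yx => yx; apply/eqP; apply: anti; rewrite yx.
have cF : closure_contains F e.
  apply/forallP => x; apply/forallP => y; apply/implyP => exy.
  by rewrite !ancE; apply: cov.
apply: leq_trans (bigmin_leq _ _ (i := F) _ _) _; rewrite ?mem_index_enum ?fF //.
apply/bigmax_leqP => x _; apply: leq_trans (crd x _); last by rewrite inE.
by apply: subset_leq_card; apply/subsetP => y; rewrite !inE ancE.
Qed.

(** * Gauss-Jordan elimination *)

Lemma row_equiv_trans m n (A B C : 'M[rat]_(m, n)) :
  row_equiv A B -> row_equiv B C -> row_equiv A C.
Proof.
move=> AB; elim=> [|D i j a _ AD ij|D i a _ AD a0] //; first exact: row_equiv_add.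
exact: row_equiv_scale.
Qed.

Lemma row_equiv_ker m n (A B : 'M[rat]_(m, n)) (v : 'cV[rat]_n) :
  row_equiv A B -> A *m v = 0 <-> B *m v = 0.
Proof.
have rowP (C : 'M[rat]_(m, n)) : C *m v = 0 <-> forall k, row k C *m v = 0.
  split=> [h k|h]; first by rewrite -row_mul h row0.
  by apply/row_matrixP => k; rewrite row_mul h row0.
elim=> [//|C i j a _ IH ij|C i a _ IH a0]; rewrite IH !rowP; split=> h k.
- by rewrite rowK; case: eqP => // _; rewrite mulmxDl -scalemxAl !h scaler0 addr0.
- have hj : row j C *m v = 0 by have := h j; rewrite rowK eq_sym (negPf ij).
  have := h k; rewrite rowK; case: eqP => // ->.
  by rewrite mulmxDl -scalemxAl hj scaler0 addr0.
- by rewrite rowK; case: eqP => // _; rewrite -scalemxAl h scaler0.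
have := h k; rewrite rowK; case: eqP => // ->; rewrite -scalemxAl.
by move/eqP; rewrite scaler_eq0 (negPf a0) /= => /eqP.
Qed.

(** A row operation changes one row, so the rows are treated along a duplicate-free list while row
    [i] stays fixed. *)
Lemma row_equiv_eliminate m n (A : 'M[rat]_(m, n)) i (a : 'I_m -> rat) :
  row_equiv A (\matrix_(k < m) (if k == i then row i A else row k A + a k *: row i A)).
Proof.
suff h (s : seq 'I_m) : uniq s -> row_equiv A (\matrix_(k < m)
    (if (k == i) || (k \notin s) then row k A else row k A + a k *: row i A)).
  have := h (enum 'I_m) (enum_uniq _); congr row_equiv; apply/row_matrixP => k.
  by rewrite !rowK mem_enum orbF; case: eqP => // ->.
elim: s => [_|k s IH /= /andP[ks us]].
  have := row_equiv_refl A; congr row_equiv; apply/row_matrixP => k.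
  by rewrite rowK orbT.
have [->|ki] := eqVneq k i.
  have := IH us; congr row_equiv; apply/row_matrixP => l; rewrite !rowK inE.
  by case: eqP.
have := row_equiv_add (a k) (IH us) ki; congr row_equiv; apply/row_matrixP => l.
rewrite !rowK inE eqxx /= ks orbT; have [->|lk] := eqVneq l k; last by [].
by rewrite (negPf ki).
Qed.

Lemma row_equiv_pivot m n (A : 'M[rat]_(m, n)) i b : A i b != 0 ->
  exists B, [/\ row_equiv A B, forall j, B i j = A i j / A i b &
    forall k j, k != i -> B k j = A k j - A k b * B i j].
Proof.
move=> Aib.
have h1 := row_equiv_scale i (row_equiv_refl A) (invr_neq0 Aib).
set B1 := \matrix_(k < m) _ in h1.
have h2 := row_equiv_eliminate B1 i (fun k => - A k b).
set B2 := \matrix_(k < m) _ in h2.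
have B2i j : B2 i j = A i j / A i b.
  by rewrite !mxE eqxx !mxE eqxx !mxE mulrC.
exists B2; split=> //; first exact: row_equiv_trans h1 h2.
move=> k j ki; rewrite B2i !mxE (negPf ki) !mxE (negPf ki) eqxx !mxE.
by rewrite mulNr [_^-1 * _]mulrC.
Qed.

(** Row exchanges are not among the operations, so pivots stay where they are found and [rho]
    records their rows. The shape [m.+1] provides a value of [rho] off [S]. *)
Lemma gauss_jordan m n (A : 'M[rat]_(m.+1, n)) (S : {set 'I_n}) :
  (forall v : 'cV_n, A *m v = 0 -> supp v \subset S -> v = 0) ->
  exists B (rho : 'I_n -> 'I_m.+1), [/\ row_equiv A B, {in S &, injective rho} &
    forall b k, b \in S -> B k b = (k == rho b)%:R].
Proof.
have [N] := ubnP #|S|; elim: N S => // N IH S; rewrite ltnS => leN ind.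
have [->|[b bS]] := set_0Vmem S.
  by exists A, (fun=> ord0); split=> [|x y|x y]; rewrite ?inE //; exact: row_equiv_refl.
have [||B [rho [AB rinj rB]]] := IH (S :\ b).
- by rewrite (cardsD1 b) bS in leN.
- by move=> v Av vS; apply: ind => //; apply: subset_trans vS (subD1set _ _).
(* If column [b] vanished outside the earlier pivot rows, it would be a combination of the earlier
   pivot columns, and [v] a nonzero kernel vector on [S]. *)
have [i ri Bib] : exists2 i, (forall c, c \in S :\ b -> rho c != i) & B i b != 0.
  apply: contrapT => no.
  pose v : 'cV[rat]_n := \col_j (if j == b then 1 else
     if j \in S then - B (rho j) b else 0).
  have v0 : v != 0 by apply/col_neq0P; exists b; rewrite mxE eqxx oner_eq0.
  move/eqP: v0; apply; apply: ind; last first.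
    apply/subsuppP => j jS; rewrite mxE (negPf jS); case: eqP => // jb.
    by rewrite jb bS in jS.
  apply/(row_equiv_ker _ AB); apply: col_eqP => k; rewrite !mxE (bigD1 b) //=.
  rewrite !mxE eqxx mulr1.
  have [[c cS kc]|nk] := pselect (exists2 c, c \in S :\ b & rho c = k).
    have [cb cS'] : c != b /\ c \in S by move: cS; rewrite !inE => /andP[].
    rewrite (bigD1 c) //= !mxE (negPf cb) cS' (rB c) // kc eqxx mul1r big1 ?addr0 ?subrr //.
    move=> j /andP[jb jc]; rewrite !mxE (negPf jb); case: ifP => jS; last by rewrite mulr0.
    have jS' : j \in S :\ b by rewrite !inE jb.
    rewrite rB // -kc; case: eqP => [/rinj cj|_]; last by rewrite mul0r.
    by rewrite cj ?eqxx // in jc.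
  rewrite big1 => [|j jb].
    rewrite addr0; apply/eqP/negPn/negP => Bk; apply: no; exists k => // c cS.
    by apply/eqP => ck; apply: nk; exists c.
  rewrite !mxE (negPf jb); case: ifP => jS; last by rewrite mulr0.
  have jS' : j \in S :\ b by rewrite !inE jb.
  rewrite rB //; case: eqP => [kj|_]; last by rewrite mul0r.
  by case: nk; exists j.
have [C [BC Ci Ck]] := row_equiv_pivot Bib.
exists C, (fun x => if x == b then i else rho x); split.
- exact: row_equiv_trans AB BC.
- move=> x y xS yS; case: (eqVneq x b) => [->|xb]; case: (eqVneq y b) => [->|yb] //.
  + by move=> iy; have := ri y; rewrite !inE yb yS -iy eqxx => /(_ isT).
  + by move=> ix; have := ri x; rewrite !inE xb xS ix eqxx => /(_ isT).
  by apply: rinj; rewrite !inE ?xb ?yb.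
move=> x k xS; have [->|xb] := eqVneq x b.
  have [->|ki] := eqVneq k i; first by rewrite Ci divff.
  by rewrite Ck // Ci divff // mulr1 subrr.
have xS' : x \in S :\ b by rewrite !inE xb.
have Cix : C i x = 0 by rewrite Ci rB // eq_sym (negPf (ri _ xS')) mul0r.
have [->|ki] := eqVneq k i; first by rewrite Cix eq_sym (negPf (ri _ xS')).
by rewrite Ck // Cix mulr0 subr0 rB.
Qed.

(** * Conformal decomposition and the Graver bound *)

(** Steinitz rearrangement in dimension one: continue with an element whose sign opposes the partial
    sum [p]. One exists because the remaining values add up to [- p]. *)
Lemma balanced_order (T : eqType) (v : T -> int) (M : nat) (s : seq T) (p : int) :
  (forall x, x \in s -> `|v x| <= M%:Z) -> `|p| <= M%:Z ->
  p + \sum_(x <- s) v x = 0 ->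
  exists2 s', perm_eq s s' &
    forall k, `|p + \sum_(x <- take k s') v x| <= M%:Z.
Proof.
have [k] := ubnP (size s); elim: k s p => // k IH s p; rewrite ltnS => lek vM pM sum0.
have [s0|sn0] := eqVneq s [::].
  by exists [::]; [rewrite s0 | move=> l; rewrite big_nil addr0].
have [x xs xsgn] : exists2 x, x \in s & (if 0 < p then v x <= 0 else 0 <= v x).
  apply: contrapT => no.
  have xs x : x \in s -> ~ (if 0 < p then v x <= 0 else 0 <= v x).
    by move=> xs h; apply: no; exists x.
  case: s {lek vM IH no} sn0 sum0 xs => // y s _; rewrite big_cons => sum0 no.
  have := no y (mem_head _ _); move: sum0.
  have {}no z : z \in s -> ~ (if 0 < p then v z <= 0 else 0 <= v z).
    by move=> zs; apply: no; rewrite inE zs orbT.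
  case: ifP no => p0 no sum0 /negP; rewrite -ltNge => vy.
    have : 0 <= \sum_(z <- s) v z.
      rewrite big_seq; apply: sumr_ge0 => z /no /negP; rewrite -ltNge; exact: ltW.
    by move: sum0 p0 vy; move: (\sum_(z <- s) v z) (v y) => S w; lia.
  have : \sum_(z <- s) v z <= 0.
    rewrite big_seq; apply: sumr_le0 => z /no /negP; rewrite -ltNge; exact: ltW.
  by move: sum0 p0 vy; move: (\sum_(z <- s) v z) (v y) => S w; lia.
have ps := perm_to_rem xs.
have [|y ys|||s' ps' s'M] := IH (rem x s) (p + v x).
- by rewrite (perm_size ps) in lek.
- by apply: vM; apply: mem_rem ys.
- by have := vM x xs; move: xsgn pM; case: ifP; lia.
- by rewrite -addrA; move: sum0; rewrite (perm_big _ ps) big_cons.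
exists (x :: s'); first by rewrite (perm_trans ps) // perm_cons.
by case=> [|l]; rewrite /= ?big_nil ?addr0 // big_cons addrA.
Qed.

Lemma zero_subsum (T : eqType) (v : T -> int) (M : nat) (s : seq T) :
  (forall x, x \in s -> `|v x| <= M%:Z) -> \sum_(x <- s) v x = 0 ->
  (2 * M + 1 < size s)%N ->
  exists t t', [/\ perm_eq s (t ++ t'), t != [::], t' != [::] & \sum_(x <- t) v x = 0].
Proof.
move=> vM sum0 Ms.
have [||s' ps s'M] := @balanced_order T v M s 0 vM; [by rewrite normr0 | by rewrite add0r |].
pose P k := \sum_(x <- take k s') v x.
have PM k : `|P k| <= M%:Z by have := s'M k; rewrite add0r.
(* There are [2 * M + 1] integers between [- M] and [M]. Only proper prefixes compete: the full sum
   equals the empty one and would leave [t'] empty. *)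
pose f (k : 'I_(size s)) : 'I_(2 * M).+1 := inord (absz (P k + M%:Z)).
have /injectivePn [i [j ij fij]] : ~~ injectiveb f.
  by apply/negP => /injectiveP /leq_card; rewrite !card_ord leqNgt -addn1 Ms.
wlog lij : i j ij fij / (i < j)%N.
  move=> h; case: (ltngtP i j) => [|ji|/val_inj eij]; first exact: h.
    by apply: (h j i); rewrite // eq_sym.
  by rewrite eij eqxx in ij.
have Pij : P i = P j.
  have := congr1 val fij; rewrite /= !inordK; have := PM i; have := PM j; lia.
have js : (j < size s')%N by rewrite -(perm_size ps).
exists (drop i (take j s')), (take i s' ++ drop j s'); split.
- rewrite (perm_trans ps) // perm_sym perm_catCA catA.
  by rewrite -[take i s'](take_takel _ (ltnW lij)) !cat_take_drop.
- by rewrite -size_eq0 size_drop size_take js subn_eq0 -ltnNge.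
- by rewrite -size_eq0 size_cat size_drop addn_eq0 negb_and orbC subn_eq0 -ltnNge js.
apply: (addrI (P i)); rewrite addr0 {2}Pij /P -big_cat /=.
by rewrite -[in take i s'](take_takel _ (ltnW lij)) cat_take_drop.
Qed.

(** The betweenness form is linear, so [lia] can use it in place of the product. *)
Lemma conformal_coordP (a b : int) :
  `|b| <= `|a| /\ 0 <= b * a <-> (0 <= b /\ b <= a) \/ (a <= b /\ b <= 0).
Proof.
split=> [[ba]|[[b0 ba]|[ab b0]]]; last 2 first.
- by split; [lia | apply: mulr_ge0 => //; lia].
- by split; [lia | apply: mulr_le0 => //; lia].
case: (ltrgtP 0 a) => a0.
- by rewrite pmulr_lge0 // => b0; left; lia.
- by rewrite nmulr_lge0 // => b0; right; lia.
by move=> _; left; lia.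
Qed.

Section GraverBound.
Context (m n : nat) (A : 'M[int]_(m, n)) (D : nat).
Context (AD : forall i j, `|A i j| <= D%:Z).
Implicit Types (R : {set 'I_m}) (x y z : 'cV[int]_n).

Definition zker R x := forall i, i \in R -> (A *m x) i 0 = 0.

Definition conformal_min R x := [/\ x != 0, zker R x
  & forall y, y != 0 -> zker R y -> conformal_le y x -> y = x].

Definition int_adj (i j : 'I_m) := i != j /\ exists k, A i k != 0 /\ A j k != 0.

(** Unlike [conformal_le], closed under addition in [y], so it passes to sums of some of the
    summands of [x]. *)
Definition same_orthant x y := forall i, 0 <= y i 0 * x i 0 /\ (x i 0 = 0 -> y i 0 = 0).

Lemma conformal_orthant x y : conformal_le y x -> same_orthant x y.
Proof. by move=> h i; have [h1 h2] := h i; split=> // xi; move: h1; rewrite xi; lia. Qed.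

Lemma conformal_trans x y z : conformal_le x y -> conformal_le y z -> conformal_le x z.
Proof.
move=> xy yz i; apply/conformal_coordP.
have /conformal_coordP h1 := xy i; have /conformal_coordP h2 := yz i.
by move: (x i 0) (y i 0) (z i 0) h1 h2 => a b c; lia.
Qed.

Lemma orthant_conformal x y z : same_orthant x y -> same_orthant x z ->
  x = y + z -> conformal_le y x.
Proof.
move=> xy xz xE i; have [h1 h2] := xy i; have [h3 h4] := xz i.
have xi : x i 0 = y i 0 + z i 0 by rewrite xE mxE.
apply/conformal_coordP; case: (ltrgtP 0 (x i 0)) => x0.
- by move: h1 h3; rewrite !pmulr_lge0 // xi => h1 h3; left; rewrite lerDl.
- by move: h1 h3; rewrite !nmulr_lge0 // xi => h1 h3; right; rewrite gerDl.
by left; rewrite h2 -?x0.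
Qed.

Lemma norm1_conformal_eq x y : conformal_le x y -> (norm1 y <= norm1 x)%N -> x = y.
Proof.
move=> xy yx; apply: col_eqP => i.
have le1 (j : 'I_n) : (`|x j 0%R| <= `|y j 0%R|)%N by have [h _] := xy j; move: h; lia.
have : (`|y i 0%R| <= `|x i 0%R|)%N.
  move: yx; rewrite /norm1 (bigD1 i) //= [X in (_ <= X)%N](bigD1 i) //=.
  have := @leq_sum _ (index_enum 'I_n) (fun j => j != i) (fun j => `|x j 0%R|%N) (fun j => `|y j 0%R|%N)
    (fun j _ => le1 j).
  set a := (\sum_(_ | _) _)%N; set b := (\sum_(_ | _) _)%N; lia.
have /conformal_coordP := xy i.
by move: (x i 0) (y i 0) => a b; lia.
Qed.

Lemma norm1_eq0 x : (norm1 x == 0%N) = (x == 0).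
Proof.
rewrite /norm1 sum_nat_eq0; apply/forallP/eqP => [h|-> i]; last by rewrite mxE.
by apply: col_eqP => i; have := h i; rewrite mxE /= absz_eq0 => /eqP.
Qed.

Lemma norm1D x y : (norm1 (x + y) <= norm1 x + norm1 y)%N.
Proof.
rewrite /norm1 -big_split /=; apply: leq_sum => i _; rewrite mxE.
by move: (x i 0%R) (y i 0%R) => a b; lia.
Qed.

(** A nonzero kernel vector of least norm below [x] is conformally minimal, and subtracting it
    leaves a shorter vector still below [x]. *)
Lemma conformal_decomposition R x : zker R x -> exists s : seq 'cV[int]_n,
  [/\ forall h, h \in s -> conformal_min R h, forall h, h \in s -> conformal_le h x &
      x = \sum_(h <- s) h].
Proof.
have [k] := ubnP (norm1 x); elim: k x => // k IH x; rewrite ltnS => lek Rx.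
have [->|x0] := eqVneq x 0; first by exists [::]; split=> //; rewrite big_nil.
have xx : conformal_le x x by move=> i; split=> //; rewrite -expr2 sqr_ge0.
have [y [[y0 Ry yx] ymin]] := @exists_min _ (fun y => [/\ y != 0, zker R y & conformal_le y x])
  (@norm1 n) (ex_intro _ x (And3 x0 Rx xx)).
have ycm : conformal_min R y.
  split=> // z z0 Rz zy; apply: norm1_conformal_eq => //; apply: ymin; split=> //.
  exact: conformal_trans zy yx.
have xyx : conformal_le (x - y) x.
  move=> i; have /conformal_coordP := yx i; rewrite !mxE => h; apply/conformal_coordP.
  by move: (x i 0) (y i 0) h => a b; lia.
have Rxy : zker R (x - y).
  by move=> i iR; rewrite mulmxBr mxE Rx // mxE Ry // subrr.
have lt : (norm1 (x - y) < norm1 x)%N.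
  rewrite ltnNge; apply/negP => /(norm1_conformal_eq xyx) xyE.
  by move/eqP: y0; apply; rewrite -[y](subKr x) xyE subrr.
have [s [s1 s2 s3]] := IH _ (leq_trans lt lek) Rxy.
exists (y :: s); split=> [h|h|].
- by rewrite inE => /orP[/eqP ->|/s1].
- by rewrite inE => /orP[/eqP ->//|/s2 hxy]; apply: conformal_trans hxy xyx.
- by rewrite big_cons -s3 addrC subrK.
Qed.

Lemma orthant_sum x (s : seq 'cV[int]_n) : (forall h, h \in s -> same_orthant x h) ->
  same_orthant x (\sum_(h <- s) h).
Proof.
move=> hs; rewrite big_seq; elim/big_ind: _ => // [i|y z xy xz i].
  by rewrite !mxE mul0r.
have [h1 h2] := xy i; have [h3 h4] := xz i; rewrite !mxE mulrDl addr_ge0 //; split=> // xi.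
by rewrite h2 // h4.
Qed.

Lemma orthant_sum_neq0 x (s : seq 'cV[int]_n) :
  (forall h, h \in s -> same_orthant x h /\ h != 0) -> s != [::] ->
  \sum_(h <- s) h != 0.
Proof.
case: s => // y s hs _; rewrite big_cons.
have [xy /col_neq0P[i yi]] := hs y (mem_head _ _).
have xs : same_orthant x (\sum_(h <- s) h).
  by apply: orthant_sum => h hs'; have [] := hs h; rewrite // inE hs' orbT.
have [h1 h2] := xy i; have [h3 h4] := xs i.
apply/col_neq0P; exists i; rewrite mxE.
have xi : x i 0 != 0 by apply: contra_neq yi.
by move: h1 h3 xi yi; move: (y i 0) (x i 0) ((\sum_(h <- s) h) i 0); clear => a b c; nia.
Qed.

(** Without rows the minimal vectors are signed unit vectors, of norm 1. If summands have norm at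
    most [g], a root row with entries at most [D] takes values at most [D * g] on them, and at most
    [2 * (D * g) + 1] summands occur. *)
Fixpoint graver_bound (D d : nat) : nat :=
  if d is d'.+1 then graver_bound D d' * (2 * (D * graver_bound D d') + 1) else 1.

Lemma graver_bound_gt0 d : (0 < graver_bound D d)%N.
Proof. by elim: d => //= d IH; rewrite muln_gt0 IH addn1. Qed.

Lemma zker_swap R x y : zker R x -> (forall i j, i \in R -> A i j != 0 -> y j 0 = x j 0) ->
  zker R y.
Proof.
move=> Rx yx i iR; rewrite -(Rx i iR) !mxE; apply: eq_bigr => j _.
by have [->|Aij] := eqVneq (A i j) 0; rewrite ?mul0r // (yx i j).
Qed.

Lemma zker0 R : zker R 0.
Proof. by move=> i _; rewrite mulmx0 mxE. Qed.

(** [N] collects the columns met by [R1]. Cutting [x] down to [N] stays in both kernels, so by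
    minimality [x] lives on [N] or avoids it; then one row set holds automatically for all vectors
    conformal to [x]. *)
Lemma conformal_min_union R1 R2 x : [disjoint R1 & R2] ->
  (forall i j, i \in R1 -> j \in R2 -> ~ int_adj i j) ->
  conformal_min (R1 :|: R2) x -> conformal_min R1 x \/ conformal_min R2 x.
Proof.
move=> dis no [x0 Rx xmin].
pose N := [set j | [exists i in R1, A i j != 0]].
have inN i j : i \in R1 -> A i j != 0 -> j \in N.
  by move=> iR Aij; rewrite inE; apply/exists_inP; exists i.
have outN i j : i \in R2 -> A i j != 0 -> j \notin N.
  move=> iR Aij; rewrite inE; apply/exists_inPn => k kR; apply/negP => Akj.
  case: (no k i kR iR); split; last by exists j.
  by apply: contraTneq kR => ->; rewrite (disjointFl dis).
have Rx1 : zker R1 x by move=> i iR; apply: Rx; rewrite inE iR.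
have Rx2 : zker R2 x by move=> i iR; apply: Rx; rewrite inE iR orbT.
have RU y : zker R1 y -> zker R2 y -> zker (R1 :|: R2) y.
  by move=> y1 y2 i; rewrite inE => /orP[/y1|/y2].
pose x1 : 'cV[int]_n := \col_j (if j \in N then x j 0 else 0).
have x1x : conformal_le x1 x.
  by move=> i; rewrite mxE; case: ifP => _; split; rewrite ?normr0 ?mul0r // -expr2 sqr_ge0.
have sub0 y i : conformal_le y x -> x i 0 = 0 -> y i 0 = 0.
  by move=> /conformal_orthant /(_ i)[_].
have [x10|x10] := eqVneq x1 0.
  right; split=> // y y0 Ry yx; apply: xmin => //; apply: RU => //.
  apply: (zker_swap (@zker0 R1)) => i j iR Aij; rewrite mxE; apply: sub0 => //.
  by have /matrixP/(_ j 0) := x10; rewrite !mxE (inN i).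
have xx1 : x1 = x.
  apply: xmin => //; apply: RU.
    by apply: (zker_swap Rx1) => i j iR Aij; rewrite mxE (inN i).
  by apply: (zker_swap (@zker0 R2)) => i j iR Aij; rewrite !mxE (negPf (outN _ _ iR Aij)).
left; split=> // y y0 Ry yx; apply: xmin => //; apply: RU => //.
apply: (zker_swap (@zker0 R2)) => i j iR Aij; rewrite mxE; apply: sub0 => //.
by rewrite -xx1 mxE (negPf (outN _ _ iR Aij)).
Qed.

Lemma norm1_conformal_min d R x : td_le int_adj d R -> conformal_min R x ->
  (norm1 x <= graver_bound D d)%N.
Proof.
move=> h; elim: h x => {d R} [d|d r R rR _ IH|d R1 R2 dis no _ IH1 _ IH2] x.
- move=> [x0 _ xmin]; have [i xi] := col_neq0P _ x0.
  pose y : 'cV[int]_n := \col_j (if j == i then Num.sg (x i 0) else 0).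
  have <- : y = x.
    apply: xmin; first by apply/col_neq0P; exists i; rewrite mxE eqxx sgr_eq0.
      by move=> j; rewrite inE.
    move=> j; rewrite mxE; case: eqP => [->|_]; last by split; rewrite ?normr0 ?mul0r.
    split; last by rewrite -normrEsg normr_ge0.
    by rewrite normr_sg xi; move: xi; move: (x i 0) => a a0; rewrite /=; lia.
  rewrite /norm1 (bigD1 i) //= big1 => [|j ji]; last by rewrite mxE (negPf ji).
  rewrite addn0 mxE eqxx; apply: leq_trans (graver_bound_gt0 d).
  have := normr_sg (x i 0); rewrite xi /=; move: (Num.sg _) => a; lia.
- move=> [x0 Rx xmin]; set g := graver_bound D d.
  have [|s [s1 s2 s3]] := @conformal_decomposition R x.
    by move=> i iR; apply: Rx; rewrite inE iR orbT.
  have snorm (h : 'cV_n) : h \in s -> (norm1 h <= g)%N by move/s1; apply: IH.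
  have small : (size s <= 2 * (D * g) + 1)%N.
    rewrite leqNgt; apply/negP => big.
    pose v (h : 'cV[int]_n) := (A *m h) r 0.
    have vsum t : v (\sum_(h <- t) h) = \sum_(h <- t) v h.
      by rewrite /v mulmx_sumr summxE.
    have [h hs||t [t' [pst t0 t'0 vt]]] := @zero_subsum _ v (D * g) s _ _ big.
    + apply: le_trans (_ : (D * norm1 h)%:Z <= _); last by rewrite lez_nat leq_mul // snorm.
      rewrite /v mxE; apply: le_trans (ler_norm_sum _ _ _) _.
      rewrite /norm1 big_distrr /= -[Posz _]natz natr_sum; apply: ler_sum => j _.
      rewrite normrM natz PoszM abszE; exact: ler_wpM2r.
    + by rewrite -vsum -s3; apply: Rx; exact: setU11.
    have tin h : h \in t -> h \in s by move=> ht; rewrite (perm_mem pst) mem_cat ht.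
    have t'in h : h \in t' -> h \in s by move=> ht; rewrite (perm_mem pst) mem_cat ht orbT.
    have ort h : h \in s -> same_orthant x h /\ h != 0.
      by move=> hs; have [h0 _ _] := s1 h hs; split=> //; apply/conformal_orthant/s2.
    have xtt : x = \sum_(h <- t) h + \sum_(h <- t') h by rewrite s3 (perm_big _ pst) big_cat.
    (* By minimality the part [t] already sums to [x], so the nonempty rest sums to zero, which is
       impossible within one orthant. *)
    have tx : \sum_(h <- t) h = x.
      apply: xmin.
      * by apply: (@orthant_sum_neq0 x) => // h /tin /ort.
      * move=> i; rewrite inE => /orP[|iR].
          by rewrite inE => /eqP ->; rewrite -[LHS]/(v _) vsum.
        rewrite mulmx_sumr summxE big_seq big1 // => h /tin /s1 [_ Rh _]; exact: Rh.
      apply: orthant_conformal xtt; apply: orthant_sum => h hh.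
        by have [] := ort h (tin h hh).
      by have [] := ort h (t'in h hh).
    have : \sum_(h <- t') h != 0 by apply: (@orthant_sum_neq0 x) => // h /t'in /ort.
    by move=> /eqP; apply; apply: (addrI x); rewrite -{1}tx -xtt addr0.
  rewrite /= -/g; apply: leq_trans (_ : size s * g <= _)%N; last by rewrite mulnC leq_mul2l small orbT.
  rewrite s3; elim: s snorm {s1 s2 s3 small} => [|h s IHs] snorm.
    by rewrite big_nil leqn0 norm1_eq0.
  rewrite big_cons; apply: leq_trans (norm1D _ _) _; rewrite mulSn leq_add //.
    by apply: snorm; rewrite mem_head.
  by apply: IHs => h' hs; apply: snorm; rewrite inE hs orbT.
by move=> /(conformal_min_union dis) [i j iR jR|/IH1|/IH2] //; have [] := no _ _ iR jR.
Qed.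

End GraverBound.

(** * Integral circuits *)

Lemma in_ker_subspace m n (A : 'M[rat]_(m, n)) : subspace (in_ker A).
Proof.
split=> [|a u v]; rewrite /in_ker ?mulmx0 // => Au Av.
by rewrite mulmxDr -scalemxAr Au Av scaler0 addr0.
Qed.

Lemma supp_intr n (x : 'cV[int]_n) : supp (map_mx (intr : int -> rat) x) = supp x.
Proof. by apply/setP => i; rewrite !in_supp mxE intr_eq0. Qed.

Lemma intr_mx_eq0 n (x : 'cV[int]_n) : (map_mx (intr : int -> rat) x == 0) = (x == 0).
Proof.
apply/eqP/eqP => [h|->]; last by rewrite map_mx0.
by apply: col_eqP => i; move/matrixP/(_ i 0): h; rewrite !mxE => /eqP; rewrite intr_eq0 => /eqP.
Qed.

Lemma circuit_elementary m n (A : 'M[rat]_(m, n)) x :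
  circuit A x -> elementary (in_ker A) (map_mx (intr : int -> rat) x).
Proof.
by move=> [x0 Ax _ xmin]; split=> //; [rewrite intr_mx_eq0 | rewrite supp_intr].
Qed.

Definition gcdv n (x : 'cV[int]_n) := (\big[gcdn/0%N]_(i < n) `|x i 0%R|)%N.

Lemma gcdvZ n c (x : 'cV[int]_n) : gcdv (c *: x) = (`|c| * gcdv x)%N.
Proof.
rewrite /gcdv (big_morph (fun k => `|c| * k)%N (muln_gcdr _) (muln0 _)).
by apply: eq_bigr => i _; rewrite mxE abszM.
Qed.

Lemma norm1Z n c (x : 'cV[int]_n) : norm1 (c *: x) = (`|c| * norm1 x)%N.
Proof.
by rewrite /norm1 big_distrr; apply: eq_bigr => i _; rewrite mxE abszM.
Qed.

Lemma gcdv_dvd n (x : 'cV[int]_n) i : (gcdv x %| `|x i 0%R|)%N.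
Proof.
rewrite /gcdv; have := mem_index_enum i; elim: (index_enum _) => // j s IH.
rewrite inE big_cons => /orP[/eqP <-|/IH]; first exact: dvdn_gcdl.
by apply: dvdn_trans; apply: dvdn_gcdr.
Qed.

Lemma le_norm1 n (x : 'cV[int]_n) i : (`|x i 0%R| <= norm1 x)%N.
Proof. by rewrite /norm1 (bigD1 i) //= leq_addr. Qed.

Lemma card_supp_norm1 n (x : 'cV[int]_n) : (#|supp x| <= norm1 x)%N.
Proof.
rewrite -sum1_card /norm1 [X in (_ <= X)%N](bigID (mem (supp x))) /=.
apply: leq_trans (leq_addr _ _); apply: leq_sum => i.
by rewrite in_supp absz_gt0.
Qed.

Lemma elementary_circuit m n (A : 'M[rat]_(m, n)) (y : 'cV[rat]_n) :
  elementary (in_ker A) y ->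
  exists x q, [/\ circuit A x, q != 0 & map_mx (intr : int -> rat) x = q *: y].
Proof.
move=> ey; have [y0 Vy ymin] := ey.
pose d := \prod_(i < n) denq (y i 0).
have d0 : d != 0 by apply/prodf_neq0 => i _; rewrite denq_neq0.
pose z : 'cV[int]_n := \col_i (numq (y i 0) * \prod_(j < n | j != i) denq (y j 0)).
have zy : map_mx intr z = d%:~R *: y.
  apply: col_eqP => i; rewrite !mxE.
  have -> : d = denq (y i 0) * \prod_(j < n | j != i) denq (y j 0) by rewrite /d (bigD1 i).
  by rewrite !intrM numqE; ring.
have [i yi] := col_neq0P _ y0.
have zi : z i 0 != 0.
  have : (map_mx (intr : int -> rat) z) i 0 != 0 by rewrite zy mxE mulf_neq0 // intr_eq0.
  by rewrite mxE intr_eq0.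
have g0 : gcdv z != 0%N.
  apply: contra_neq zi => g0; have := gcdv_dvd z i; rewrite g0 dvd0n => /eqP /eqP.
  by rewrite absz_eq0 => /eqP.
pose x : 'cV[int]_n := \col_i (z i 0%R %/ (gcdv z)%:Z)%Z.
have zx : z = (gcdv z)%:Z *: x.
  apply: col_eqP => j; rewrite [RHS]mxE [x _ _]mxE mulrC divzK //.
  by rewrite dvdzE /= gcdv_dvd.
pose q : rat := d%:~R / (gcdv z)%:~R.
have g0' : ((gcdv z)%:~R : rat) != 0 by rewrite intr_eq0.
have q0 : q != 0 by rewrite mulf_neq0 ?invr_eq0 // intr_eq0.
have xy : map_mx (intr : int -> rat) x = q *: y.
  apply: (scalerI g0'); rewrite scalerA mulrCA divff // mulr1 -zy {2}zx.
  by apply: col_eqP => j; rewrite !mxE intrM.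
exists x, q; split=> //.
have sx : supp x = supp y.
  by rewrite -supp_intr xy; apply/setP => j; rewrite !in_supp mxE mulf_eq0 (negPf q0).
split.
- by rewrite -intr_mx_eq0 xy scaler_eq0 negb_or q0.
- by rewrite /int_in_ker /in_ker xy -scalemxAr Vy scaler0.
- rewrite /coprime_entries -/(gcdv x); have := gcdvZ (gcdv z)%:Z x; rewrite -zx /= => /eqP.
  by rewrite -{1}[gcdv z]muln1 eqn_pmul2l ?lt0n // => /eqP <-.
- by rewrite sx.
Qed.

Lemma circuit_prop m n (A : 'M[rat]_(m, n)) x y : circuit A x -> int_in_ker A y ->
  supp y \subset supp x -> exists a b : int, b != 0 /\ b *: y = a *: x.
Proof.
move=> cx Ay yx; have ex := circuit_elementary cx.
have [|q yq] := elementary_prop (in_ker_subspace A) ex Ay; first by rewrite !supp_intr.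
exists (numq q), (denq q); split; first exact: denq_neq0.
apply: col_eqP => i; apply: (@intr_inj rat); rewrite !mxE !intrM.
have /matrixP/(_ i 0) := yq; rewrite !mxE => ->; rewrite mulrA [_ * q]mulrC.
by rewrite numqE.
Qed.

(** Circuits of equal support are proportional, and coprimality leaves only a sign. Hence the
    finitely many supports bound the norms of all circuits. *)
Lemma circuit_supp_norm1 m n (A : 'M[rat]_(m, n)) x y : circuit A x -> circuit A y ->
  supp y = supp x -> norm1 y = norm1 x.
Proof.
move=> cx cy sxy; have [_ Ay gy _] := cy; have [_ _ gx _] := cx.
have [|a [b [b0 byax]]] := circuit_prop cx Ay; first by rewrite sxy.
have := congr1 (@gcdv n) byax; rewrite !gcdvZ /gcdv gx gy !muln1 => ab.
have := congr1 (@norm1 n) byax; rewrite !norm1Z ab => /eqP.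
by rewrite -ab eqn_pmul2l ?absz_gt0 // => /eqP.
Qed.

(** A kernel vector conformal to a circuit is a multiple of it, by coprimality an integral one,
    hence not shorter. *)
Lemma circuit_graver m n (A : 'M[rat]_(m, n)) x : circuit A x -> graver A x.
Proof.
move=> cx; have [x0 Ax gx _] := cx; split=> // y y0 Ay yx.
have sub : supp y \subset supp x.
  apply/subsuppP => i; rewrite in_supp negbK => /eqP xi.
  by have [h _] := yx i; move: h; rewrite xi normr0 normr_le0 => /eqP.
have [a [b [b0 byax]]] := circuit_prop cx Ay sub.
have := congr1 (@gcdv n) byax; rewrite !gcdvZ {2}/gcdv gx muln1 => ab.
have gy : (0 < gcdv y)%N.
  rewrite lt0n; apply: contra_neq y0 => g0; apply: col_eqP => i; rewrite mxE.
  by have := gcdv_dvd y i; rewrite g0 dvd0n absz_eq0 => /eqP.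
apply: norm1_conformal_eq => //.
have := congr1 (@norm1 n) byax; rewrite !norm1Z -ab -mulnA => /eqP.
by rewrite eqn_pmul2l ?absz_gt0 // => /eqP ->; rewrite leq_pmull.
Qed.

Lemma circuit_bounded m n (A : 'M[rat]_(m, n)) :
  exists K, forall x, circuit A x -> (norm1 x <= K)%N.
Proof.
have /choice[f fP] : forall S : {set 'I_n}, exists k,
    forall x, circuit A x -> supp x = S -> norm1 x = k.
  move=> S.
  have [[x [cx xS]]|no] := pselect (exists x, circuit A x /\ supp x = S).
    by exists (norm1 x) => y cy yS; apply: circuit_supp_norm1 cx cy _; rewrite yS.
  by exists 0%N => x cx xS; case: no; exists x.
exists (\max_S f S)%N => x cx; rewrite (fP (supp x)) //.
exact: (leq_bigmax (F := f)).
Qed.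

Lemma max_norm1P n (P : 'cV[int]_n -> Prop) K : (exists x, P x) ->
  (forall x, P x -> (norm1 x <= K)%N) -> is_max_norm1 P (max_norm1 P).
Proof.
move=> exP PK; apply: classical_sets.xgetPex.
have [x [Px xmin]] := exists_min (fun x => K - norm1 x)%N exP.
exists (norm1 x); split; first by exists x.
by move=> y Py; have := xmin y Py; have := PK y Py; have := PK x Px; lia.
Qed.

(** * The reduced form and the final bounds *)

Lemma leq_num_den_div (a b : int) : b != 0 ->
  (`|numq (a%:~R / b%:~R)| <= `|a|)%N /\ (`|denq (a%:~R / b%:~R)| <= `|b|)%N.
Proof.
move=> b0; set r := a%:~R / b%:~R.
have [a0|a0] := eqVneq a 0.
  by rewrite /r a0 mul0r; split; rewrite // absz_gt0.
have E : numq r * b = a * denq r.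
  apply: (@intr_inj rat); rewrite !intrM numqE mulrAC.
  by rewrite /r divfK ?intr_eq0.
have {}E : (`|numq r| * `|b| = `|a| * `|denq r|)%N by rewrite -!abszM E.
have cop := coprime_num_den r.
split; apply: dvdn_leq; rewrite ?absz_gt0 //.
  by rewrite -(Gauss_dvdl _ cop) -E dvdn_mulr.
by rewrite coprime_sym in cop; rewrite -(Gauss_dvdr _ cop) E dvdn_mull.
Qed.

Definition bounded_rat (c : nat) (r : rat) := (`|numq r| <= c)%N /\ (`|denq r| <= c)%N.

Lemma reduced_form m n (A : 'M[rat]_(m, n)) c : (0 < c)%N ->
  (forall x, circuit A x -> (norm1 x <= c)%N) ->
  exists B, [/\ row_equiv A B, forall i j, bounded_rat c (B i j)
    & td_le (fun i j => dual_graph B i j) (c * c.-1).+1 [set: 'I_m]].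
Proof.
move=> c0 Ac; case: m A Ac => [|m] A Ac.
  exists A; split=> [|[]//|]; first exact: row_equiv_refl.
  rewrite (_ : [set: _] = set0); first exact: td_le0.
  by apply/setP => -[].
have sV := in_ker_subspace A.
have [||S [_ Sind Sspan] tdS] := @exists_shallow_basis _ _ (in_ker A) setT c sV.
- by move=> v _; apply: subsetT.
- move=> y /elementary_circuit[x [q [cx q0 xy]]].
  apply: leq_trans (Ac x cx); apply: leq_trans (card_supp_norm1 x).
  apply: subset_leq_card; apply/subsetP => i; rewrite -supp_intr xy !in_supp mxE => yi.
  by rewrite mulf_neq0.
have [B [rho [AB rinj rB]]] := gauss_jordan Sind.
have Bentry e : e \notin S -> exists y, [/\ in_ker A y, y e 0 = 1,
    forall j, j \notin S -> j != e -> y j 0 = 0,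
    forall b, b \in S -> B (rho b) e = - y b 0 &
    forall k, (forall b, b \in S -> rho b != k) -> B k e = 0].
  move=> eS; have [y [Ay ye ys]] := Sspan e (in_setT e) eS.
  (* Row [k] of [B *m y = 0]: apart from column [e], where [y] is 1, only pivot columns
     contribute. *)
  have By k : B k e + \sum_(b in S) (k == rho b)%:R * y b 0 = 0.
    have /(row_equiv_ker _ AB) /matrixP/(_ k 0) := Ay.
    rewrite !mxE (bigD1 e) //= ye mulr1 => E; rewrite -[RHS]E; congr (_ + _).
    rewrite [RHS](bigID (mem S)) /= [X in _ = _ + X]big1 ?addr0; last first.
      by move=> j /andP[je jS]; rewrite ys ?mulr0 // in_setT.
    apply: eq_big => [b|b bS]; last by rewrite rB.
    by apply/idP/andP => [bS|[]//]; split=> //; apply: contraNneq eS => <-.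
  exists y; split=> //; first by move=> j; apply: ys; rewrite in_setT.
  - move=> b bS; apply/eqP; rewrite -addr_eq0 -[X in _ == X](By (rho b)); apply/eqP.
    rewrite (bigD1 b) //= eqxx mul1r big1 ?addr0 // => b' /andP[b'S b'b].
    by case: eqP => [/rinj bb'|_]; rewrite ?mul0r // bb' ?eqxx in b'b *.
  move=> k kr; rewrite -[RHS](By k) big1 ?addr0 // => b bS.
  by rewrite eq_sym (negPf (kr _ bS)) mul0r.
have b01 (b : bool) : bounded_rat c b%:R by case: b; split.
exists B; split=> // [k e|].
  have [eS|eS] := boolP (e \in S); first by rewrite rB.
  have [y [Ay ye ys yb yk]] := Bentry e eS.
  have [[b [bS <-]]|nk] := pselect (exists b, b \in S /\ rho b = k); last first.
    rewrite yk; first exact: (b01 false).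
    by move=> b bS; apply/eqP => bk; apply: nk; exists b.
  (* If [w] is supported in [supp y], then [w - w e 0 *: y] is supported in the basis and so
     vanishes. *)
  have ey : elementary (in_ker A) y.
    apply: elementaryI => //; first by apply/col_neq0P; exists e; rewrite ye oner_eq0.
    move=> w Aw wy; exists (w e 0); apply/eqP; rewrite -subr_eq0; apply/eqP.
    apply: Sind; first exact: (subspaceBZ _ sV).
    apply/subsuppP => j jS; rewrite !mxE; have [->|je] := eqVneq j e.
      by rewrite ye mulr1 subrr.
    rewrite (ys j) // mulr0 subr0; apply: (subsuppP _ _ wy).
    by rewrite in_supp ys // eqxx.
  have [x [q [cx q0 /matrixP xy]]] := elementary_circuit ey.
  have xe := xy e 0; have xb := xy b 0; rewrite !mxE ye mulr1 in xe xb.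
  have xe0 : x e 0 != 0 by rewrite -(intr_eq0 rat) xe.
  have -> : B (rho b) e = (- x b 0)%:~R / (x e 0)%:~R.
    by rewrite yb // intrN xe xb mulNr mulrAC divff // mul1r.
  have [h1 h2] := leq_num_den_div (- x b 0) xe0; split.
    by apply: leq_trans h1 _; rewrite abszN; apply: leq_trans (le_norm1 _ _) (Ac x cx).
  by apply: leq_trans h2 _; apply: leq_trans (le_norm1 _ _) (Ac x cx).
(* Rows without a pivot are isolated vertices of the dual graph and need depth 1 only. *)
have zero_row k : k \notin rho @: S -> forall e, B k e = 0.
  move=> kS e; have kr b : b \in S -> rho b != k.
    by move=> bS; apply: contraNneq kS => <-; apply: imset_f.
  have [eS|eS] := boolP (e \in S); first by rewrite rB // eq_sym (negPf (kr _ eS)).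
  by have [y [_ _ _ _]] := Bentry e eS; apply.
have no_edge k l : k \notin rho @: S -> ~ dual_graph B k l /\ ~ dual_graph B l k.
  by move=> kS; split=> /andP[_ /existsP[e]]; rewrite (zero_row _ kS) eqxx ?andbF.
rewrite -(setUCr (rho @: S)); apply: td_le_union.
- by rewrite -setI_eq0 setICr.
- by move=> x y _; rewrite inE => /no_edge h; have [h1 h2] := h x.
- apply: td_le_image tdS rinj _ => b b' bS b'S /andP[bb' /existsP[e /andP[be b'e]]].
  (* A pivot column has a single nonzero entry and joins no two rows. *)
  have [eS|eS] := boolP (e \in S).
    move: be b'e; rewrite !rB //; case: (rho b =P rho e) => [<-|_]; last by rewrite eqxx.
    by rewrite [rho b' == _]eq_sym (negPf bb') eqxx.
  have [y [Ay ye ys yb _]] := Bentry e eS; exists y, e; split=> //.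
  + by move=> j _; apply: ys.
  + by rewrite -oppr_eq0 -yb.
  + by rewrite -oppr_eq0 -yb.
apply: (@td_le_leq _ _ 1) => //; apply: td_le_edgeless => x y.
by rewrite inE => /no_edge h _ _; have [] := h y.
Qed.

(** Denominators at most [c] divide the factorial of [c]. Scaling by it makes [B] integral, with
    entries at most [c] times that factorial, and preserves the kernel and the dual graph. *)
Lemma graver_bounded m n (B : 'M[rat]_(m, n)) c d x :
  (forall i j, bounded_rat c (B i j)) ->
  td_le (fun i j => dual_graph B i j) d [set: 'I_m] -> graver B x ->
  (norm1 x <= graver_bound (c * c`!) d)%N.
Proof.
move=> Bc tdB gx.
pose C : 'M[int]_(m, n) := \matrix_(i, j) (numq (B i j) * (c`! %/ `|denq (B i j)|)%N%:Z).
have CB i j : (C i j)%:~R = c`!%:R * B i j.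
  have dd : (`|denq (B i j)| %| c`!)%N.
    by apply: dvdn_fact; rewrite absz_gt0 denq_neq0; have [_ ->] := Bc i j.
  rewrite mxE intrM numqE -mulrA mulrC; congr (_ * _).
  rewrite -[denq _]gez0_abs ?denq_ge0 // -intrM -PoszM mulnC divnK //.
have f0 : (c`!%:R : rat) != 0 by rewrite pnatr_eq0 -lt0n fact_gt0.
have CB0 i j : (C i j != 0) = (B i j != 0).
  by rewrite -(intr_eq0 rat) CB mulf_eq0 (negPf f0).
have kerE (y : 'cV[int]_n) : zker C setT y <-> int_in_ker B y.
  have E i : ((C *m y) i 0)%:~R = c`!%:R * (B *m map_mx intr y) i 0 :> rat.
    rewrite !mxE rmorph_sum /= mulr_sumr; apply: eq_bigr => j _.
    by rewrite intrM CB mxE mulrA.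
  split=> h.
    apply: col_eqP => i; apply: (mulfI f0); rewrite -E h ?in_setT //.
    by rewrite mxE mulr0.
  by move=> i _; apply: (@intr_inj rat); rewrite E h mxE mulr0.
apply: (@norm1_conformal_min _ _ C (c * c`!) _ d setT).
- move=> i j; rewrite mxE -abszE lez_nat abszM; apply: leq_mul; first by have [] := Bc i j.
  exact: leq_div.
- apply: (td_le_sub tdB) => i j _ _ [ij [k]]; rewrite !CB0 => -[h1 h2].
  by rewrite /dual_graph ij; apply/existsP; exists k; rewrite h1.
by have [x0 Ax xmin] := gx; split=> // [|y y0 /kerE]; [apply/kerE | apply: xmin].
Qed.

(** Each logarithm is at most [c] because [c < 2 ^ c]. *)
Lemma bounded_rat_complexity c r : bounded_rat c r -> (rat_complexity r <= 2 * c)%N.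
Proof.
move=> [h1 h2]; rewrite mul2n -addnn; apply: leq_add.
  by apply: up_log_min => //; rewrite addn1; apply: leq_ltn_trans h1 (ltn_expl _ _).
by apply: up_log_min => //; rewrite addn1; apply: leq_ltn_trans h2 (ltn_expl _ _).
Qed.

Local Close Scope ring_scope.

Theorem theorem6 :
  exists f1 : nat -> nat,
  forall (m n : nat) (A : 'M[rat]_(m, n)),
    0 < dim_ker A ->
    (exists A' : 'M[rat]_(m, n),
        [/\ row_equiv A A', td_D A' <= c1 A ^ 2 & ec A' <= 2 * c1 A])
    /\ c1 A <= g1 A <= f1 (c1 A).
Proof.
exists (fun c => graver_bound (c * c`!) (c * c.-1).+1) => m n A dimA.
have [x0 cx0] : exists x, circuit A x.
  have [v [Av v0]] : exists v : 'cV[rat]_n, in_ker A v /\ v != 0%R.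
    have /matrix0Pn[i [j Kij]] : cokermx A != 0%R.
      by rewrite -mxrank_eq0 -lt0n.
    exists (col j (cokermx A)); split; first by rewrite /in_ker colE mulmxA mulmx_coker mul0mx.
    by apply/col_neq0P; exists i; rewrite mxE.
  have [i vi] := col_neq0P _ v0.
  have [z [ez _ _]] := elementary_through (in_ker_subspace A) Av vi.
  by have [x [q [cx _ _]]] := elementary_circuit ez; exists x.
have [K AK] := circuit_bounded A.
have [[x cx xc1] c1P] : is_max_norm1 (circuit A) (c1 A).
  by apply: max_norm1P AK; exists x0.
have c1_gt0 : 0 < c1 A.
  by rewrite -xc1 lt0n norm1_eq0; case: cx.
have [B [AB Bc tdB]] := reduced_form c1_gt0 c1P.
have Agraver y : graver A y -> norm1 y <= graver_bound (c1 A * (c1 A)`!) (c1 A * (c1 A).-1).+1.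
  have kerE z : int_in_ker A z <-> int_in_ker B z by apply: row_equiv_ker.
  move=> [y0 Ay ymin]; apply: graver_bounded Bc tdB _.
  by split=> // [|z z0 /kerE]; [apply/kerE | apply: ymin].
have gx := circuit_graver cx.
(* The bound also shows that the maximum exists, so [g1 A] is not the default value. *)
have [[y gy yg1] g1P] : is_max_norm1 (graver A) (g1 A).
  by apply: max_norm1P Agraver; exists x.
split; last by rewrite -{1}xc1 g1P //= -yg1 Agraver.
exists B; split=> //.
  (* [c * (c - 1) + 1 <= c ^ 2] because [c1 A] is positive. *)
  apply: leq_trans (td_le_tree_depth _ tdB) _; last by nia.
  by move=> i; rewrite /dual_graph eqxx.
apply/bigmax_leqP => i _; apply/bigmax_leqP => j _; exact: bounded_rat_complexity.
Qed.
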